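(* Let $\Bbbk$ be a field, let $q_1,q_2\in\Bbbk^*$ each have a square root in $\Bbbk$, and let $a_1,a_2\in\Bbbk[h^{\pm 1}]$ be Laurent polynomials. Let $\sigma_{inv}$ be the automorphism of $\Bbbk[h_1^{\pm1}]$ with $\sigma_{inv}(h_1)=q_1h_1^{-1}$ and let $\sigma_{inv}'$ be the automorphism of $\Bbbk[h_2^{\pm 1}]$ with $\sigma_{inv}'(h_2)=q_2h_2^{-1}$. Then the $\Bbbk$-algebras $\Bbbk[h_1^{\pm 1}](\sigma_{inv},a_1(h_1))$ and $\Bbbk[h_2^{\pm 1}](\sigma_{inv}',a_2(h_2))$ are isomorphic if and only if $$a_2\bigl(q_2^{\tau}h_2^{(-1)^{\tau}}\bigr)=p\,h_2^{l}\,a_1(\alpha h_2^{\epsilon})$$ for some $p\in\Bbbk^*$, $l\in\mathbb{Z}$, $\tau\in\{0,1\}$, $\epsilon\in\{1,-1\}$ and $\alpha\in\Bbbk^*$ with $\alpha^2=q_1q_2^{-\epsilon}$.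
   Context: For a $\Bbbk$-algebra $R$, a $\Bbbk$-algebra automorphism $\sigma$ of $R$ and a central element $a\in R$, the (degree-one) generalized Weyl algebra $R(\sigma,a)$ is the $\Bbbk$-algebra extension of $R$ generated by two indeterminates $x$ and $y$ subject to the relations $yx=a$, $xy=\sigma(a)$, $xr=\sigma(r)x$ and $yr=\sigma^{-1}(r)y$ for all $r\in R$. *)

(* Defs.v *)
From HB Require Import structures.
From mathcomp Require Import all_boot all_order all_algebra.
From mathcomp Require Import generic_quotient.
From mathcomp Require Import finmap.
From mathcomp Require Import boolp zify.
From mathcomp.multinomials Require Import monalg.

Set Implicit Arguments.
Unset Strict Implicit.
Unset Printing Implicit Defensive.

Import GRing.Theory.
Local Open Scope ring_scope.

(* The multiplication of {malg k[K]} in monalg needs a monoid K without       *)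
(* nontrivial units, which excludes K = int; only its module structure is     *)
(* reused below. An element f is the Laurent polynomial \sum_i f@_i h^i.      *)
Definition laurent (k : fieldType) : Type := {malg k[int]}.

HB.instance Definition _ (k : fieldType) :=
  GRing.Lmodule.copy (laurent k) {malg k[int]}.

Section LaurentRing.
Variable k : fieldType.
Local Notation L := (laurent k).
Implicit Types f g : L.

Local Open Scope fset.

Definition lone : L := << 1 *g (0 : int) >>.

(* locked, so that conversion does not try to compute products *)
Fact lmul_key : unit. Proof. by []. Qed.
Definition lmul : L -> L -> L := locked_with lmul_key (fun f g : L =>
  \sum_(i <- msupp f) \sum_(j <- msupp g) << f@_i * g@_j *g (i + j)%R >>).

Lemma lmul_def f g : lmul f g =
  \sum_(i <- msupp f) \sum_(j <- msupp g) << f@_i * g@_j *g (i + j)%R >>.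
Proof. by rewrite /lmul unlock. Qed.

Lemma lmulw (d1 d2 : {fset int}) f g :
  msupp f `<=` d1 -> msupp g `<=` d2 ->
  lmul f g = \sum_(i <- d1) \sum_(j <- d2) << f@_i * g@_j *g (i + j)%R >>.
Proof.
move=> le1 le2; rewrite lmul_def (big_fset_incl _ le1) /=.
  apply: eq_bigr => i _; apply: big_fset_incl => // j _ /mcoeff_outdom ->.
  by rewrite mulr0 monalgU0.
by move=> i _ /mcoeff_outdom fi; rewrite big1 // => j _; rewrite fi mul0r monalgU0.
Qed.

Lemma lmulC : commutative lmul.
Proof.
move=> f g; rewrite !lmul_def exchange_big; apply: eq_bigr => i _.
by apply: eq_bigr => j _; rewrite mulrC addrC.
Qed.

Lemma lmulDl : left_distributive lmul +%R.
Proof.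
move=> f1 f2 g.
rewrite (lmulw (msuppD_le f1 f2) (fsubset_refl (msupp g))).
rewrite (lmulw (fsubsetUl _ (msupp f2)) (fsubset_refl (msupp g))).
rewrite (lmulw (fsubsetUr (msupp f1) _) (fsubset_refl (msupp g))).
rewrite -big_split /=; apply: eq_bigr => i _.
rewrite -big_split /=; apply: eq_bigr => j _.
by rewrite mcoeffD mulrDl monalgUD.
Qed.

Lemma lmulDr : right_distributive lmul +%R.
Proof. by move=> f g1 g2; rewrite !(lmulC f) lmulDl. Qed.

Lemma lmul0f : left_zero (0 : L) lmul.
Proof. by move=> f; rewrite lmul_def msupp0 big_seq_fset0. Qed.

Lemma lmulf0 : right_zero (0 : L) lmul.
Proof. by move=> f; rewrite lmulC lmul0f. Qed.

Lemma lmulUU (c d : k) (i j : int) :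
  lmul << c *g i >> << d *g j >> = << c * d *g (i + j)%R >>.
Proof. by rewrite (lmulw msuppU_le msuppU_le) !big_seq_fset1 !mcoeffUU. Qed.

Lemma lmul_suml (I : Type) (r : seq I) (F : I -> L) g :
  lmul (\sum_(i <- r) F i) g = \sum_(i <- r) lmul (F i) g.
Proof. exact: (big_morph (lmul^~ g) (fun x y => lmulDl x y g) (lmul0f g)). Qed.

Lemma lmul_sumr (I : Type) (r : seq I) (F : I -> L) f :
  lmul f (\sum_(i <- r) F i) = \sum_(i <- r) lmul f (F i).
Proof. exact: (big_morph (lmul f) (lmulDr f) (lmulf0 f)). Qed.

Lemma lmulA : associative lmul.
Proof.
have UU (c d : k) (i j : int) e :
    lmul << c *g i >> (lmul << d *g j >> e) = lmul << c * d *g (i + j)%R >> e.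
  rewrite (monalgE e) (lmul_sumr _ _ << d *g j >>) (lmul_sumr _ _ << c *g i >>).
  rewrite (lmul_sumr _ _ << c * d *g (i + j)%R >>); apply: eq_bigr => l _.
  by rewrite !lmulUU mulrA addrA.
have U (c : k) (i : int) g e :
    lmul << c *g i >> (lmul g e) = lmul (lmul << c *g i >> g) e.
  rewrite (monalgE g) (lmul_suml _ _ e) 2!(lmul_sumr _ _ << c *g i >>).
  by rewrite (lmul_suml _ _ e); apply: eq_bigr => j _; rewrite UU lmulUU.
move=> f g e; rewrite (monalgE f) (lmul_suml _ _ (lmul g e)) (lmul_suml _ _ g).
by rewrite (lmul_suml _ _ e); apply: eq_bigr => i _; rewrite U.
Qed.

Lemma lmul1f : left_id lone lmul.
Proof.
move=> f; rewrite (monalgE f) lmul_sumr; apply: eq_bigr => i _.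
by rewrite lmulUU mul1r add0r.
Qed.

Lemma lone_neq0 : lone != 0.
Proof. by apply/eqP/malgP => /(_ 0) /eqP; rewrite !mcoeffsE oner_eq0. Qed.

HB.instance Definition _ := GRing.Zmodule_isComNzRing.Build (laurent k)
  lmulA lmulC lmul1f lmulDl lone_neq0.

Lemma lscaleAl (c : k) f g : c *: (f * g) = (c *: f) * g.
Proof.
have ZU d (i : int) : c *: << d *g i >> = << c * d *g i >> :> L.
  by apply/malgP => j; rewrite mcoeffZ !mcoeffU mulrnAr.
change (c *: lmul f g = lmul (c *: f) g).
rewrite (monalgE f) (lmul_suml _ _ g) !scaler_sumr (lmul_suml _ _ g).
apply: eq_bigr => i _; rewrite ZU (monalgE g).
rewrite (lmul_sumr _ _ << f@_i *g i >>) (lmul_sumr _ _ << c * f@_i *g i >>).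
by rewrite scaler_sumr; apply: eq_bigr => j _; rewrite !lmulUU ZU mulrA.
Qed.

HB.instance Definition _ :=
  GRing.Lmodule_isLalgebra.Build k (laurent k) lscaleAl.
HB.instance Definition _ := GRing.Lalgebra_isComAlgebra.Build k (laurent k).

Lemma lmulE f g : f * g = lmul f g. Proof. by []. Qed.

Definition lunit : {pred L} := fun f => `[< exists g, g * f = 1 >].

Lemma lunitP f : lunit f -> exists g, g * f == 1.
Proof. by move=> /asboolP[g fg]; exists g; apply/eqP. Qed.

Definition linv f : L :=
  match boolP (lunit f) with
  | AltTrue uf => xchoose (lunitP uf)
  | AltFalse _ => f
  end.

Lemma lmulVf : {in lunit, left_inverse 1 linv *%R}.
Proof.
move=> f; rewrite /linv unfold_in; case: {-}_ / boolP => [uf|/negP//] _.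
exact/eqP/(xchooseP (lunitP uf)).
Qed.

Lemma lunitPl f g : g * f = 1 -> lunit f.
Proof. by move=> gf; apply/asboolP; exists g. Qed.

Lemma linv_out : {in [predC lunit], linv =1 id}.
Proof.
move=> f nuf; rewrite /linv; case: {-}_ / boolP => // uf.
by case/negP: nuf.
Qed.

HB.instance Definition _ := GRing.ComNzRing_hasMulInverse.Build (laurent k)
  lmulVf lunitPl linv_out.

Definition lvar : L := << 1 *g (1 : int) >>.

Lemma lvar_unit : lvar \is a GRing.unit.
Proof.
apply/unitrPr; exists (<< 1 *g (-1 : int) >> : L).
by rewrite lmulE lmulUU mulr1 subrr.
Qed.

Lemma lvarX (i : int) : lvar ^ i = << 1 *g i >> :> L.
Proof.
have XS (j : int) : (<< 1 *g (1 + j)%R >> : L) = lvar * << 1 *g j >>.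
  by rewrite lmulE lmulUU mulr1.
have posX (n : nat) : lvar ^+ n = << 1 *g (n : int) >> :> L.
  by elim: n => [//|n IHn]; rewrite exprS IHn -XS -intS.
case: i => n; first exact: posX.
rewrite NegzE -exprnN; apply: (mulIr (unitrX n.+1 lvar_unit)).
rewrite mulVr ?unitrX ?lvar_unit // posX.
by rewrite lmulE lmulUU mulr1 addNr.
Qed.

Lemma laurentE f : f = \sum_(i <- msupp f) f@_i *: lvar ^ i.
Proof.
rewrite {1}(monalgE f); apply: eq_bigr => i _; rewrite lvarX.
by apply/malgP => j; rewrite mcoeffZ !mcoeffU mulr_natr.
Qed.

End LaurentRing.

(* f(u); only meaningful for a unit u.                                        *)
Definition leval (k : fieldType) (A : unitAlgType k) (u : A) (f : laurent k) : A :=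
  \sum_(i <- msupp f) f@_i *: u ^ i.

Section LevalTheory.
Variable k : fieldType.
Local Notation L := (laurent k).
Local Open Scope fset.

Section Morphism.
Variables (A : unitAlgType k) (u : A).
Hypothesis uu : u \is a GRing.unit.

Lemma levalw (d : {fset int}) (f : L) :
  msupp f `<=` d -> leval u f = \sum_(i <- d) f@_i *: u ^ i.
Proof.
move=> le; rewrite /leval (big_fset_incl _ le) //= => i _ /mcoeff_outdom ->.
by rewrite scale0r.
Qed.

Lemma leval_is_linear : linear (leval u : L -> A).
Proof.
move=> c f g; pose d := msupp f `|` msupp g.
have sf : msupp f `<=` d by exact: fsubsetUl.
have sg : msupp g `<=` d by exact: fsubsetUr.
have scf : msupp (c *: f) `<=` d by apply: fsubset_trans sf; exact: msuppZ_le.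
have sD : msupp (c *: f + g) `<=` d.
  by apply: fsubset_trans (msuppD_le _ _) _; rewrite fsubUset scf sg.
rewrite (levalw sf) (levalw sg) (levalw sD) scaler_sumr -big_split /=.
by apply: eq_bigr => i _; rewrite mcoeffD mcoeffZ scalerDl scalerA.
Qed.

Lemma levalU (c : k) (i : int) : leval u (<< c *g i >> : L) = c *: u ^ i.
Proof. by rewrite (levalw msuppU_le) big_seq_fset1 mcoeffUU. Qed.

Lemma leval_lvar : leval u (lvar k) = u.
Proof. by rewrite levalU scale1r expr1z. Qed.

Lemma leval_is_monoid_morphism : monoid_morphism (leval u : L -> A).
Proof.
pose e0 : {linear L -> A} :=
  HB.pack (leval u) (GRing.isLinear.Build _ _ _ _ _ leval_is_linear).
have [e eE] : exists e : {linear L -> A}, e =1 leval u by exists e0.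
have eU c i : e << c *g i >> = c *: u ^ i by rewrite eE levalU.
split; first by rewrite -eE eU scale1r expr0z.
move=> f g; rewrite -!eE lmulE.
rewrite (monalgE f) (lmul_suml _ _ g) !raddf_sum mulr_suml.
apply: eq_bigr => i _; rewrite (monalgE g) (lmul_sumr _ _ << f@_i *g i >>).
rewrite !raddf_sum mulr_sumr; apply: eq_bigr => j _.
by rewrite lmulUU /= !eU exprzDr // -scalerAl -scalerAr scalerA.
Qed.

Definition leval_lrmorphism : {lrmorphism L -> A} :=
  HB.pack (leval u) (GRing.isLinear.Build _ _ _ _ _ leval_is_linear)
    (GRing.isMonoidMorphism.Build _ _ _ leval_is_monoid_morphism).

End Morphism.

Lemma lrmorph_leval (A : unitAlgType k) (phi : {lrmorphism L -> A}) f :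
  phi f = leval (phi (lvar k)) f.
Proof.
rewrite {1}(laurentE f) linear_sum; apply: eq_bigr => i _.
by rewrite linearZ /= rmorphXz ?lvar_unit.
Qed.

Lemma leval_id f : leval (lvar k) f = f.
Proof. by rewrite [RHS]laurentE. Qed.

End LevalTheory.

Record algaut (k : fieldType) (R : algType k) := AlgAut {
  aut_fun :> {lrmorphism R -> R};
  aut_inv : R -> R;
  autK : cancel aut_fun aut_inv;
  autVK : cancel aut_inv aut_fun
}.

Definition alg_iso (k : fieldType) (A B : algType k) : Prop :=
  exists phi : {lrmorphism A -> B}, bijective phi.

(* For q != 0 there is exactly one automorphism sending h to q h^-1.          *)
Lemma laurent_aut_ext (k : fieldType) (s t : algaut (laurent k)) :
  s (lvar k) = t (lvar k) -> s =1 t.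
Proof. by move=> st f; rewrite (lrmorph_leval s) (lrmorph_leval t) st. Qed.

Lemma laurent_inv_aut (k : fieldType) (q : k) : q != 0 ->
  exists s : algaut (laurent k), s (lvar k) = q *: (lvar k)^-1.
Proof.
move=> q0; have qU : q \is a GRing.unit by rewrite unitfE.
have hU := lvar_unit k; set v := q *: _.
have vE : v = q *: (lvar k)^-1 by [].
have vU : v \is a GRing.unit by rewrite scaler_unit // unitrV.
have [s sh] : exists s : {lrmorphism laurent k -> laurent k}, s (lvar k) = v.
  by exists (leval_lrmorphism vU); exact: leval_lvar.
have sv : s v = lvar k.
  rewrite vE linearZ /= (rmorphV s hU) /= sh vE invrZ ?qU ?unitrV ?hU //.
  by rewrite invrK scalerA mulfV ?q0 // scale1r.
have sK : cancel s s.
  move=> f; rewrite -[LHS]/((s \o s) f).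
  rewrite (lrmorph_leval (s \o s : {lrmorphism laurent k -> laurent k})) /=.
  by rewrite sh sv leval_id.
by exists (AlgAut sK sK).
Qed.

(* The generalized Weyl algebra R(sigma, a) for a commutative R, so that a is *)
(* automatically central, presented as a k-algebra: formal expressions in the *)
(* elements of R and the two indeterminates, modulo the smallest k-algebra    *)
(* congruence making R -> R(sigma, a) a k-algebra morphism and containing the *)
(* four defining relations.                                                   *)
Inductive gwa_term (R : Type) (k : Type) : Type :=
| GCst of R
| GX
| GY
| GAdd of gwa_term R k & gwa_term R k
| GOpp of gwa_term R k
| GMul of gwa_term R k & gwa_term R k
| GScale of k & gwa_term R k.

Arguments GCst {R k}.
Arguments GX {R k}.
Arguments GY {R k}.

HB.instance Definition _ R k := gen_eqMixin (gwa_term R k).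
HB.instance Definition _ R k := gen_choiceMixin (gwa_term R k).

Section GWA.
Variables (k : fieldType) (R : comAlgType k) (sigma : algaut R) (a : R).

Local Notation T := (gwa_term R k).

Inductive gwa_eq : T -> T -> Prop :=
| geq_refl t : gwa_eq t t
| geq_sym t u : gwa_eq t u -> gwa_eq u t
| geq_trans t u v : gwa_eq t u -> gwa_eq u v -> gwa_eq t v
| geq_add t t' u u' :
    gwa_eq t t' -> gwa_eq u u' -> gwa_eq (GAdd t u) (GAdd t' u')
| geq_opp t t' : gwa_eq t t' -> gwa_eq (GOpp t) (GOpp t')
| geq_mul t t' u u' :
    gwa_eq t t' -> gwa_eq u u' -> gwa_eq (GMul t u) (GMul t' u')
| geq_scale c t t' : gwa_eq t t' -> gwa_eq (GScale c t) (GScale c t')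
| geq_addA t u v : gwa_eq (GAdd t (GAdd u v)) (GAdd (GAdd t u) v)
| geq_addC t u : gwa_eq (GAdd t u) (GAdd u t)
| geq_add0 t : gwa_eq (GAdd (GCst 0) t) t
| geq_addN t : gwa_eq (GAdd (GOpp t) t) (GCst 0)
| geq_mulA t u v : gwa_eq (GMul t (GMul u v)) (GMul (GMul t u) v)
| geq_mul1l t : gwa_eq (GMul (GCst 1) t) t
| geq_mul1r t : gwa_eq (GMul t (GCst 1)) t
| geq_mulDl t u v : gwa_eq (GMul (GAdd t u) v) (GAdd (GMul t v) (GMul u v))
| geq_mulDr t u v : gwa_eq (GMul t (GAdd u v)) (GAdd (GMul t u) (GMul t v))
| geq_scaleA c d t : gwa_eq (GScale c (GScale d t)) (GScale (c * d) t)
| geq_scale1 t : gwa_eq (GScale 1 t) t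
| geq_scaleDr c t u :
    gwa_eq (GScale c (GAdd t u)) (GAdd (GScale c t) (GScale c u))
| geq_scaleDl c d t :
    gwa_eq (GScale (c + d) t) (GAdd (GScale c t) (GScale d t))
| geq_scaleAl c t u : gwa_eq (GScale c (GMul t u)) (GMul (GScale c t) u)
| geq_scaleAr c t u : gwa_eq (GScale c (GMul t u)) (GMul t (GScale c u))
| geq_cstD r s : gwa_eq (GCst (r + s)) (GAdd (GCst r) (GCst s))
| geq_cstM r s : gwa_eq (GCst (r * s)) (GMul (GCst r) (GCst s))
| geq_cstZ c r : gwa_eq (GCst (c *: r)) (GScale c (GCst r))
| geq_YX : gwa_eq (GMul GY GX) (GCst a)
| geq_XY : gwa_eq (GMul GX GY) (GCst (sigma a))
| geq_Xr r : gwa_eq (GMul GX (GCst r)) (GMul (GCst (sigma r)) GX)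
| geq_Yr r : gwa_eq (GMul GY (GCst r)) (GMul (GCst (aut_inv sigma r)) GY).

Definition gwa_eqb (t u : T) : bool := `[< gwa_eq t u >].

Lemma gwa_eqb_refl : reflexive gwa_eqb.
Proof. by move=> t; apply/asboolP; exact: geq_refl. Qed.

Lemma gwa_eqb_sym : symmetric gwa_eqb.
Proof. by move=> t u; apply/asboolP/asboolP; exact: geq_sym. Qed.

Lemma gwa_eqb_trans : transitive gwa_eqb.
Proof.
by move=> u t v /asboolP tu /asboolP uv; apply/asboolP; exact: geq_trans uv.
Qed.

Canonical gwa_equiv :=
  EquivRel gwa_eqb gwa_eqb_refl gwa_eqb_sym gwa_eqb_trans.

Definition gwa : Type := {eq_quot gwa_equiv}%qT.

HB.instance Definition _ := Choice.copy gwa {eq_quot gwa_equiv}%qT.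

Definition gwa_pi (t : T) : gwa := (\pi_({eq_quot gwa_equiv}) t)%qT.
Definition gwa_repr (z : gwa) : T := repr (z : {eq_quot gwa_equiv}%qT).

Lemma gwa_piP t u : gwa_pi t = gwa_pi u <-> gwa_eq t u.
Proof.
split=> [/eqmodP/asboolP //|tu]; exact/eqmodP/asboolP.
Qed.

Lemma gwa_reprK : cancel gwa_repr gwa_pi.
Proof. by move=> z; exact: reprK. Qed.

Lemma gwa_pi_repr t : gwa_eq (gwa_repr (gwa_pi t)) t.
Proof. by apply/gwa_piP; rewrite gwa_reprK. Qed.

Definition gwa_add (z w : gwa) := gwa_pi (GAdd (gwa_repr z) (gwa_repr w)).
Definition gwa_opp (z : gwa) := gwa_pi (GOpp (gwa_repr z)).
Definition gwa_mul (z w : gwa) := gwa_pi (GMul (gwa_repr z) (gwa_repr w)).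
Definition gwa_scale (c : k) (z : gwa) := gwa_pi (GScale c (gwa_repr z)).

Lemma gwa_piD t u : gwa_pi (GAdd t u) = gwa_add (gwa_pi t) (gwa_pi u).
Proof. by apply/gwa_piP/geq_add; apply: geq_sym; exact: gwa_pi_repr. Qed.

Lemma gwa_piN t : gwa_pi (GOpp t) = gwa_opp (gwa_pi t).
Proof. by apply/gwa_piP/geq_opp; apply: geq_sym; exact: gwa_pi_repr. Qed.

Lemma gwa_piM t u : gwa_pi (GMul t u) = gwa_mul (gwa_pi t) (gwa_pi u).
Proof. by apply/gwa_piP/geq_mul; apply: geq_sym; exact: gwa_pi_repr. Qed.

Lemma gwa_piZ c t : gwa_pi (GScale c t) = gwa_scale c (gwa_pi t).
Proof. by apply/gwa_piP/geq_scale; apply: geq_sym; exact: gwa_pi_repr. Qed.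

Lemma gwa_ind (P : gwa -> Prop) : (forall t, P (gwa_pi t)) -> forall z, P z.
Proof. by move=> Ppi z; rewrite -(gwa_reprK z). Qed.

Definition gwa_piE := (gwa_piD, gwa_piN, gwa_piM, gwa_piZ).

(* R(sigma, a) acts on functions int -> R, seen as formal sums over n of      *)
(* f(n) v_n with v_n = x^n for n >= 0 and v_n = y^(-n) for n <= 0; hence      *)
(* R embeds in R(sigma, a), which is in particular nontrivial.                *)
Definition gwa_actX (f : int -> R) (n : int) : R :=
  sigma (f (n - 1)) * (if (0 <= n - 1)%R then 1 else sigma a).

Definition gwa_actY (f : int -> R) (n : int) : R :=
  aut_inv sigma (f (n + 1)) * (if (n + 1 <= 0)%R then 1 else a).

Fixpoint gwa_act (t : T) (f : int -> R) : int -> R :=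
  match t with
  | GCst r => fun n => r * f n
  | GX => gwa_actX f
  | GY => gwa_actY f
  | GAdd t u => fun n => gwa_act t f n + gwa_act u f n
  | GOpp t => fun n => - gwa_act t f n
  | GMul t u => gwa_act t (gwa_act u f)
  | GScale c t => fun n => c *: gwa_act t f n
  end.

Lemma aut_inv_linear : linear (aut_inv sigma : R -> R).
Proof.
move=> c r s; apply: (can_inj (autK sigma)).
by rewrite linearP /= !(autVK sigma).
Qed.

Lemma aut_invM : {morph aut_inv sigma : r s / r * s}.
Proof.
move=> r s; apply: (can_inj (autK sigma)).
by rewrite rmorphM /= !(autVK sigma).
Qed.

Lemma gwa_act_linear t c f g n :
  gwa_act t (fun m => c *: f m + g m) n
  = c *: gwa_act t f n + gwa_act t g n.
Proof.
elim: t c f g n => [r|||t IHt u IHu|t IHt|t IHt u IHu|d t IHt] /= c f g n.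
- by rewrite mulrDr scalerAr.
- by rewrite /gwa_actX linearP /= mulrDl scalerAl.
- by rewrite /gwa_actY aut_inv_linear mulrDl scalerAl.
- by rewrite IHt IHu scalerDr addrACA.
- by rewrite IHt opprD scalerN.
- rewrite -IHt; congr (gwa_act t _ n).
  by apply/functional_extensionality_dep => m; exact: IHu.
- by rewrite IHt scalerDr !scalerA mulrC.
Qed.

Lemma gwa_actD t f g n :
  gwa_act t (fun m => f m + g m) n = gwa_act t f n + gwa_act t g n.
Proof.
rewrite -[gwa_act t f n]scale1r -gwa_act_linear.
by congr (gwa_act t _ n); apply/functional_extensionality_dep => m; rewrite scale1r.
Qed.

Lemma gwa_actZ t c f n :
  gwa_act t (fun m => c *: f m) n = c *: gwa_act t f n.
Proof.
have t0 : gwa_act t (fun=> 0) n = 0.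
  have /eqP := gwa_actD t (fun=> 0) (fun=> 0) n.
  rewrite (_ : (fun=> 0 + 0) = (fun=> 0)); last first.
    by apply/functional_extensionality_dep => m; rewrite addr0.
  by rewrite -subr_eq subrr eq_sym => /eqP.
rewrite -[RHS]addr0 -t0 -gwa_act_linear.
by congr (gwa_act t _ n); apply/functional_extensionality_dep => m; rewrite addr0.
Qed.

Lemma gwa_act_eq t u : gwa_eq t u -> gwa_act t = gwa_act u.
Proof.
have ext (F G : (int -> R) -> int -> R) : (forall f n, F f n = G f n) -> F = G.
  move=> FG; apply/functional_extensionality_dep => f.
  exact/functional_extensionality_dep.
have VM := aut_invM.
elim=> {t u} /=.
- by [].
- by [].
- by move=> t u v _ -> _ ->.
- by move=> t t' u u' _ -> _ ->.
- by move=> t t' _ ->.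
- by move=> t t' u u' _ -> _ ->.
- by move=> c t t' _ ->.
- by move=> t u v; apply: ext => f n; rewrite addrA.
- by move=> t u; apply: ext => f n; rewrite addrC.
- by move=> t; apply: ext => f n; rewrite mul0r add0r.
- by move=> t; apply: ext => f n; rewrite mul0r addNr.
- by [].
- by move=> t; apply: ext => f n; rewrite mul1r.
- move=> t; apply: ext => f n; congr (gwa_act t _ n).
  by apply/functional_extensionality_dep => m; rewrite mul1r.
- by [].
- by move=> t u v; apply: ext => f n; rewrite gwa_actD.
- by move=> c d t; apply: ext => f n; rewrite scalerA.
- by move=> t; apply: ext => f n; rewrite scale1r.
- by move=> c t u; apply: ext => f n; rewrite scalerDr.
- by move=> c d t; apply: ext => f n; rewrite scalerDl.
- by [].
- by move=> c t u; apply: ext => f n; rewrite gwa_actZ.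
- by move=> r s; apply: ext => f n; rewrite mulrDl.
- by move=> r s; apply: ext => f n; rewrite mulrA.
- by move=> c r; apply: ext => f n; rewrite scalerAl.
- apply: ext => f n; rewrite /gwa_actY /gwa_actX addrK VM (autK sigma).
  rewrite -mulrA [RHS]mulrC; congr (_ * _).
  case: ifP => n0; case: ifP => n1; rewrite ?mulr1 ?(autK sigma) //.
  + by move: n0 n1; lia.
  + by rewrite -(rmorph1 sigma) (autK sigma) mul1r.
  + by move: n0 n1; lia.
- apply: ext => f n; rewrite /gwa_actY /gwa_actX subrK rmorphM /= (autVK sigma).
  rewrite -mulrA [RHS]mulrC; congr (_ * _).
  case: ifP => n0; case: ifP => n1; rewrite ?rmorph1 ?mul1r ?mulr1 //.
  + by move: n0 n1; lia.
  + by move: n0 n1; lia.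
- by move=> r; apply: ext => f n; rewrite /gwa_actX rmorphM /= mulrA.
- by move=> r; apply: ext => f n; rewrite /gwa_actY VM mulrA.
Qed.

Definition gwa_cst (r : R) : gwa := gwa_pi (GCst r).
Definition gwa_x : gwa := gwa_pi GX.
Definition gwa_y : gwa := gwa_pi GY.

Lemma gwa_cst_inj : injective gwa_cst.
Proof.
move=> r s /gwa_piP /gwa_act_eq /(congr1 (fun F => F (fun=> 1) 0)) /=.
by rewrite !mulr1.
Qed.

Lemma gwa_addA : associative gwa_add.
Proof.
elim/gwa_ind => t; elim/gwa_ind => u; elim/gwa_ind => v.
by rewrite -!gwa_piE; apply/gwa_piP; constructor.
Qed.

Lemma gwa_addC : commutative gwa_add.
Proof.
elim/gwa_ind => t; elim/gwa_ind => u.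
by rewrite -!gwa_piE; apply/gwa_piP; apply: geq_addC.
Qed.

Lemma gwa_add0 : left_id (gwa_cst 0) gwa_add.
Proof.
by elim/gwa_ind => t; rewrite -gwa_piE; apply/gwa_piP; apply: geq_add0.
Qed.

Lemma gwa_addN : left_inverse (gwa_cst 0) gwa_opp gwa_add.
Proof.
by elim/gwa_ind => t; rewrite -!gwa_piE; apply/gwa_piP; apply: geq_addN.
Qed.

Lemma gwa_mulA : associative gwa_mul.
Proof.
elim/gwa_ind => t; elim/gwa_ind => u; elim/gwa_ind => v.
by rewrite -!gwa_piE; apply/gwa_piP; apply: geq_mulA.
Qed.

Lemma gwa_mul1l : left_id (gwa_cst 1) gwa_mul.
Proof.
by elim/gwa_ind => t; rewrite -gwa_piE; apply/gwa_piP; apply: geq_mul1l.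
Qed.

Lemma gwa_mul1r : right_id (gwa_cst 1) gwa_mul.
Proof.
by elim/gwa_ind => t; rewrite -gwa_piE; apply/gwa_piP; apply: geq_mul1r.
Qed.

Lemma gwa_mulDl : left_distributive gwa_mul gwa_add.
Proof.
elim/gwa_ind => t; elim/gwa_ind => u; elim/gwa_ind => v.
by rewrite -!gwa_piE; apply/gwa_piP; apply: geq_mulDl.
Qed.

Lemma gwa_mulDr : right_distributive gwa_mul gwa_add.
Proof.
elim/gwa_ind => t; elim/gwa_ind => u; elim/gwa_ind => v.
by rewrite -!gwa_piE; apply/gwa_piP; apply: geq_mulDr.
Qed.

Lemma gwa_cst1_neq0 : gwa_cst 1 != gwa_cst 0.
Proof. by rewrite (inj_eq gwa_cst_inj) oner_eq0. Qed.

HB.instance Definition _ := GRing.isNzRing.Build gwa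
  gwa_addA gwa_addC gwa_add0 gwa_addN
  gwa_mulA gwa_mul1l gwa_mul1r gwa_mulDl gwa_mulDr gwa_cst1_neq0.

Lemma gwa_scaleA c d z : gwa_scale c (gwa_scale d z) = gwa_scale (c * d) z.
Proof.
elim/gwa_ind: z => t.
by rewrite -!gwa_piE; apply/gwa_piP; apply: geq_scaleA.
Qed.

Lemma gwa_scale1 : left_id 1 gwa_scale.
Proof.
by elim/gwa_ind => t; rewrite -gwa_piE; apply/gwa_piP; apply: geq_scale1.
Qed.

Lemma gwa_scaleDr : right_distributive gwa_scale +%R.
Proof.
move=> c; elim/gwa_ind => t; elim/gwa_ind => u.
change (gwa_scale c (gwa_add (gwa_pi t) (gwa_pi u)) =
  gwa_add (gwa_scale c (gwa_pi t)) (gwa_scale c (gwa_pi u))).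
by rewrite -!gwa_piE; apply/gwa_piP; apply: geq_scaleDr.
Qed.

Lemma gwa_scaleDl z : {morph gwa_scale^~ z : c d / c + d}.
Proof.
elim/gwa_ind: z => t c d.
change (gwa_scale (c + d) (gwa_pi t) =
  gwa_add (gwa_scale c (gwa_pi t)) (gwa_scale d (gwa_pi t))).
by rewrite -!gwa_piE; apply/gwa_piP; apply: geq_scaleDl.
Qed.

HB.instance Definition _ := GRing.Zmodule_isLmodule.Build k gwa
  gwa_scaleA gwa_scale1 gwa_scaleDr gwa_scaleDl.

Lemma gwa_scaleAl (c : k) (z w : gwa) : c *: (z * w) = (c *: z) * w.
Proof.
elim/gwa_ind: z => t; elim/gwa_ind: w => u.
change (gwa_scale c (gwa_mul (gwa_pi t) (gwa_pi u)) =
  gwa_mul (gwa_scale c (gwa_pi t)) (gwa_pi u)).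
by rewrite -!gwa_piE; apply/gwa_piP; apply: geq_scaleAl.
Qed.

HB.instance Definition _ := GRing.Lmodule_isLalgebra.Build k gwa gwa_scaleAl.

Lemma gwa_scaleAr (c : k) (z w : gwa) : c *: (z * w) = z * (c *: w).
Proof.
elim/gwa_ind: z => t; elim/gwa_ind: w => u.
change (gwa_scale c (gwa_mul (gwa_pi t) (gwa_pi u)) =
  gwa_mul (gwa_pi t) (gwa_scale c (gwa_pi u))).
by rewrite -!gwa_piE; apply/gwa_piP; apply: geq_scaleAr.
Qed.

HB.instance Definition _ := GRing.Lalgebra_isAlgebra.Build k gwa gwa_scaleAr.

Lemma gwa_cst_is_linear : linear gwa_cst.
Proof.
move=> c r s.
change (gwa_pi (GCst (c *: r + s)) =
  gwa_add (gwa_scale c (gwa_pi (GCst r))) (gwa_pi (GCst s))).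
rewrite -!gwa_piE; apply/gwa_piP; apply: geq_trans (geq_cstD _ _) _.
by apply: geq_add; [exact: geq_cstZ | exact: geq_refl].
Qed.

Lemma gwa_cst_is_monoid_morphism : monoid_morphism gwa_cst.
Proof.
split=> // r s.
change (gwa_pi (GCst (r * s)) = gwa_mul (gwa_pi (GCst r)) (gwa_pi (GCst s))).
by rewrite -!gwa_piE; apply/gwa_piP; apply: geq_cstM.
Qed.

HB.instance Definition _ :=
  GRing.isLinear.Build k R gwa _ gwa_cst gwa_cst_is_linear.
HB.instance Definition _ :=
  GRing.isMonoidMorphism.Build R gwa gwa_cst gwa_cst_is_monoid_morphism.

Lemma gwa_yx : gwa_y * gwa_x = gwa_cst a.
Proof.
change (gwa_mul (gwa_pi GY) (gwa_pi GX) = gwa_cst a).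
by rewrite -gwa_piE; apply/gwa_piP; apply: geq_YX.
Qed.

Lemma gwa_xy : gwa_x * gwa_y = gwa_cst (sigma a).
Proof.
change (gwa_mul (gwa_pi GX) (gwa_pi GY) = gwa_cst (sigma a)).
by rewrite -gwa_piE; apply/gwa_piP; apply: geq_XY.
Qed.

Lemma gwa_xr r : gwa_x * gwa_cst r = gwa_cst (sigma r) * gwa_x.
Proof.
change (gwa_mul (gwa_pi GX) (gwa_cst r) = gwa_mul (gwa_cst (sigma r)) (gwa_pi GX)).
by rewrite -!gwa_piE; apply/gwa_piP; apply: geq_Xr.
Qed.

Lemma gwa_yr r : gwa_y * gwa_cst r = gwa_cst (aut_inv sigma r) * gwa_y.
Proof.
change (gwa_mul (gwa_pi GY) (gwa_cst r) =
  gwa_mul (gwa_cst (aut_inv sigma r)) (gwa_pi GY)).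
by rewrite -!gwa_piE; apply/gwa_piP; apply: geq_Yr.
Qed.

Section Universal.
Variables (B : algType k) (j : {lrmorphism R -> B}) (x y : B).
Hypotheses (yxE : y * x = j a) (xyE : x * y = j (sigma a)).
Hypothesis xrE : forall r, x * j r = j (sigma r) * x.
Hypothesis yrE : forall r, y * j r = j (aut_inv sigma r) * y.

Fixpoint gwa_interp (t : T) : B :=
  match t with
  | GCst r => j r
  | GX => x
  | GY => y
  | GAdd t u => gwa_interp t + gwa_interp u
  | GOpp t => - gwa_interp t
  | GMul t u => gwa_interp t * gwa_interp u
  | GScale c t => c *: gwa_interp t
  end.

Lemma gwa_interp_eq t u : gwa_eq t u -> gwa_interp t = gwa_interp u.
Proof.
elim=> {t u} /=.
- by [].
- by [].
- by move=> t u v _ -> _ ->.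
- by move=> t t' u u' _ -> _ ->.
- by move=> t t' _ ->.
- by move=> t t' u u' _ -> _ ->.
- by move=> c t t' _ ->.
- by move=> *; rewrite addrA.
- by move=> *; rewrite addrC.
- by move=> *; rewrite rmorph0 add0r.
- by move=> *; rewrite rmorph0 addNr.
- by move=> *; rewrite mulrA.
- by move=> *; rewrite rmorph1 mul1r.
- by move=> *; rewrite rmorph1 mulr1.
- by move=> *; rewrite mulrDl.
- by move=> *; rewrite mulrDr.
- by move=> *; rewrite scalerA.
- by move=> *; rewrite scale1r.
- by move=> *; rewrite scalerDr.
- by move=> *; rewrite scalerDl.
- by move=> *; rewrite scalerAl.
- by move=> *; rewrite scalerAr.
- by move=> *; rewrite rmorphD.
- by move=> *; rewrite rmorphM.
- by move=> c r; rewrite linearZ.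
- exact: yxE.
- exact: xyE.
- exact: xrE.
- exact: yrE.
Qed.

Definition gwa_lift (z : gwa) : B := gwa_interp (gwa_repr z).

Lemma gwa_lift_pi t : gwa_lift (gwa_pi t) = gwa_interp t.
Proof. exact/gwa_interp_eq/gwa_pi_repr. Qed.

Lemma gwa_lift_is_linear : linear gwa_lift.
Proof.
move=> c; elim/gwa_ind => t; elim/gwa_ind => u.
change (gwa_lift (gwa_add (gwa_scale c (gwa_pi t)) (gwa_pi u)) =
  c *: gwa_lift (gwa_pi t) + gwa_lift (gwa_pi u)).
by rewrite -!gwa_piE !gwa_lift_pi.
Qed.

Lemma gwa_lift_is_monoid_morphism : monoid_morphism gwa_lift.
Proof.
split; first by rewrite -(rmorph1 j) -[RHS]/(gwa_interp (GCst 1)) -gwa_lift_pi.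
elim/gwa_ind => t; elim/gwa_ind => u.
change (gwa_lift (gwa_mul (gwa_pi t) (gwa_pi u)) =
  gwa_lift (gwa_pi t) * gwa_lift (gwa_pi u)).
by rewrite -!gwa_piE !gwa_lift_pi.
Qed.

Lemma gwa_universal :
  exists phi : {lrmorphism gwa -> B},
    [/\ forall r, phi (gwa_cst r) = j r, phi gwa_x = x, phi gwa_y = y &
     forall psi : {lrmorphism gwa -> B},
       (forall r, psi (gwa_cst r) = j r) -> psi gwa_x = x -> psi gwa_y = y ->
       psi =1 phi].
Proof.
pose phi : {lrmorphism gwa -> B} :=
  HB.pack gwa_lift (GRing.isLinear.Build _ _ _ _ _ gwa_lift_is_linear)
    (GRing.isMonoidMorphism.Build _ _ _ gwa_lift_is_monoid_morphism).
exists phi; split=> [r|||psi psij psix psiy]; rewrite ?gwa_lift_pi //.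
- exact: (gwa_lift_pi (GCst r)).
- exact: (gwa_lift_pi GX).
- exact: (gwa_lift_pi GY).
elim/gwa_ind => t; rewrite -[RHS]/(gwa_lift _) gwa_lift_pi.
elim: t => [r|||t IHt u IHu|t IHt|t IHt u IHu|c t IHt] /=.
- exact: psij.
- exact: psix.
- exact: psiy.
- by rewrite -IHt -IHu gwa_piD -rmorphD.
- by rewrite -IHt gwa_piN -rmorphN.
- by rewrite -IHt -IHu gwa_piM -rmorphM.
- by rewrite -IHt gwa_piZ -linearZ.
Qed.

End Universal.

End GWA.

(* Main.v *)
From HB Require Import structures.
Require Import Defs.
From mathcomp Require Import all_boot all_order all_algebra.
From mathcomp Require Import finmap boolp zify.
From mathcomp.multinomials Require Import monalg.
Import GRing.Theory.
Local Open Scope ring_scope.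
Set Implicit Arguments.
Unset Strict Implicit.
Unset Printing Implicit Defensive.

(* The algebra is Z-graded with homogeneous basis v_n = x^n, v_(-n) = y^n over
   R = k[h^(+-1)]. For a != 0 it is a domain, so both factors of a product of
   degree 0 are homogeneous. If a is moreover not a unit, all units lie in R;
   hence an isomorphism phi maps R onto R, with phi(h1) = alpha h2^(+-1), and,
   as y x = a has degree 0, phi(x) and phi(y) are homogeneous of degrees n, -n.
   Applying the inverse gives n = 1 or n = -1, so phi(a1) is a multiple of a2 or
   of sigma2(a2), and by symmetry the factor is a unit p h^l. Conjugating sigma1
   to sigma2 gives the condition on alpha. The values a = 0 and a a unit are
   recognized by zero divisors and by the noncommuting units x and h. Conversely,
   tau = 1 corresponds to exchanging x and y, as sigma2 is an involution. *)

(** * Extreme degrees of finite supports in the integers *)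

Lemma int_pred_max (p : pred int) (s : seq int) (n0 : int) :
  (forall n, p n -> n \in s) -> p n0 -> exists2 m, p m & forall n, p n -> (n <= m)%R.
Proof.
elim: s p n0 => [|i s IHs] p n0 ps pn0; first by have := ps _ pn0.
pose p' := [pred n | p n && (n != i)].
have p's n : p' n -> n \in s.
  by case/andP=> /ps; rewrite inE => /orP[/eqP->|//]; rewrite eqxx.
have [[n1 p'n1]|no] := pselect (exists n, p' n).
  have [m /andP[pm _] mmax] := IHs p' n1 p's p'n1.
  have [pi|npi] := boolP (p i).
    have [le|lt] := boolP (i <= m)%R.
      exists m => // n pn; have [->//|ni] := eqVneq n i.
      by apply: mmax; rewrite /= pn.
    exists i => // n pn; have [->//|ni] := eqVneq n i.
    have : (n <= m)%R by apply: mmax; rewrite /= pn.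
    by move: lt; lia.
  exists m => // n pn; apply: mmax; rewrite /= pn.
  by apply: contraNneq npi => <-.
have pE n : p n -> n = i.
  by move=> pn; apply: contrapT => /eqP ni; apply: no; exists n; rewrite /= pn.
by exists n0 => // n /pE ->; rewrite (pE _ pn0).
Qed.

Lemma int_pred_min (p : pred int) (s : seq int) (n0 : int) :
  (forall n, p n -> n \in s) -> p n0 -> exists2 m, p m & forall n, p n -> (m <= n)%R.
Proof.
move=> ps pn0.
have [n|/=|m pm mmax] := @int_pred_max (fun n => p (- n)) [seq - i | i <- s] (- n0).
- by move=> /ps; rewrite -{2}(opprK n) => ?; apply: map_f.
- by rewrite opprK.
- exists (- m) => // n pn; have : (- n <= m)%R by apply: mmax; rewrite opprK.
  by lia.
Qed.

(* [B m d] is the contribution to degree [d] of a graded product by the degree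
   [m] part of the first factor; the top and the bottom degrees of a product
   cannot cancel, so both are 0 when the product has degree 0. *)
Lemma graded_prod_deg0 (V : zmodType) (p q : pred int) (sp sq : seq int)
    (h : int -> V) (B : int -> int -> V) (m0 n0 : int) :
  uniq sp -> (forall m, p m -> m \in sp) -> (forall n, q n -> n \in sq) ->
  (forall d, h d = \sum_(m <- sp) B m d) ->
  (forall m d, (B m d != 0) = p m && q (d - m)) ->
  p m0 -> q n0 -> (forall d, d != 0 -> h d = 0) ->
  [/\ p m0, q (- m0), (forall m, p m -> m = m0) & (forall n, q n -> n = - m0)].
Proof.
move=> usp psp qsq hE BE pm0 qn0 h0.
(* If only the degree [M] part contributes to degree [M + N], nothing cancels there, so [M + N] must
   be 0. *)
have ext M N : p M -> q N ->
    (forall m, p m -> q (M + N - m) -> m = M) -> M + N = 0.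
  move=> pM qN ME; apply: contrapT => /eqP/h0/eqP; rewrite hE.
  rewrite (bigD1_seq M) ?psp //= big1 => [|m mM].
    by rewrite addr0; apply/negP; rewrite BE pM addrAC subrr add0r.
  apply: contrapT => /eqP; rewrite BE => /andP[pm qm].
  by rewrite (ME m) ?eqxx in mM.
have [M pM Mmax] := int_pred_max psp pm0.
have [N qN Nmax] := int_pred_max qsq qn0.
have [M' pM' Mmin] := int_pred_min psp pm0.
have [N' qN' Nmin] := int_pred_min qsq qn0.
(* The two tops add up to 0, and so do the two bottoms; this forces each support to be a single
   point. *)
have MN : M + N = 0.
  by apply: ext => // m /Mmax ? /Nmax; lia.
have MN' : M' + N' = 0.
  by apply: ext => // m /Mmin ? /Nmin; lia.
have ? := Mmax _ pM'; have ? := Nmax _ qN'.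
have ? := Mmax _ pm0; have ? := Mmin _ pm0.
have m0E : m0 = M by lia.
have n0E : - m0 = N by lia.
split; rewrite ?n0E //; [move=> m pm | move=> n qn].
  by have := Mmax _ pm; have := Mmin _ pm; lia.
by have := Nmax _ qn; have := Nmin _ qn; lia.
Qed.

(** * Zero divisors and units of the Laurent polynomial ring *)

Section LaurentDomain.
Variable k : fieldType.
Local Notation L := (laurent k).
Implicit Types f g : L.

Lemma mcoeff_lvarXM (c : k) (i n : int) g : (c *: lvar k ^ i * g)@_n = c * g@_(n - i).
Proof.
rewrite -scalerAl mcoeffZ lvarX lmulE (lmulw msuppU_le (fsubset_refl _)).
rewrite big_seq_fset1 mcoeffUU raddf_sum /= (monalgE g).
rewrite raddf_sum /= -monalgE; congr (_ * _); apply: eq_bigr => j _.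
by rewrite !mcoeffU mul1r; congr (_ *+ nat_of_bool _); apply/eqP/eqP; lia.
Qed.

Lemma mcoeff_lmul f g n :
  (f * g)@_n = \sum_(i <- msupp f) f@_i * g@_(n - i).
Proof.
rewrite {1}(laurentE f) mulr_suml raddf_sum /=; apply: eq_bigr => i _.
exact: mcoeff_lvarXM.
Qed.

Lemma laurent_neq0 f : f != 0 -> exists n, f@_n != 0.
Proof.
move=> f0; apply: contrapT => no; move/negP: f0; apply; apply/eqP/malgP => n.
by rewrite mcoeff0; apply: contrapT => /eqP fn; apply: no; exists n.
Qed.

(** The graded product lemma with [B m d] a product of two coefficients; it covers both [f * g = 0]
    and [f * g = 1], hence zero divisors and units. *)
Lemma laurent_prod_deg0 f g : f != 0 -> g != 0 ->
  (forall d, d != 0 -> (f * g)@_d = 0) ->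
  exists n, [/\ f@_n != 0, g@_(- n) != 0 & f = f@_n *: lvar k ^ n].
Proof.
move=> /laurent_neq0[m fm] /laurent_neq0[n gn] fg0.
have [|||||fm' gm fE gE] := @graded_prod_deg0 k (fun m => f@_m != 0) (fun m => g@_m != 0)
  (msupp f) (msupp g) (fun d => (f * g)@_d) (fun m d => f@_m * g@_(d - m)) m n _ _ _ _ _ fm gn fg0.
- exact: fset_uniq.
- by move=> i; rewrite mcoeff_neq0.
- by move=> i; rewrite mcoeff_neq0.
- by move=> d; exact: mcoeff_lmul.
- by move=> i d; rewrite mulf_eq0 negb_or.
exists m; split=> //; apply/malgP => i; rewrite lvarX mcoeffZ mcoeffU.
have [->|mi] := eqVneq m i; first by rewrite mulr1.
rewrite mulr0; apply: contrapT => /eqP /fE im.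
by rewrite im eqxx in mi.
Qed.

Lemma laurent_mulf_eq0 f g : (f * g == 0) = (f == 0) || (g == 0).
Proof.
apply/idP/idP => [/eqP fg|]; last first.
  by case/orP=> /eqP->; rewrite (mul0r, mulr0).
apply: contrapT => /negP; rewrite negb_or => /andP[f0 g0].
have [|n [fn gn fE]] := laurent_prod_deg0 f0 g0.
  by move=> d _; rewrite fg mcoeff0.
have /eqP : (f * g)@_0 = 0 by rewrite fg mcoeff0.
by rewrite fE mcoeff_lvarXM sub0r mulf_eq0 (negPf fn) (negPf gn).
Qed.

Lemma laurent_unit_monomial f : f \is a GRing.unit ->
  exists c n, c != 0 /\ f = c *: lvar k ^ n.
Proof.
move=> uf; have fV := divrr uf.
have f0 : f != 0 by apply: contraTneq uf => ->; rewrite unitr0.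
have g0 : f^-1 != 0 by rewrite invr_eq0.
have [|n [fn _ fE]] := laurent_prod_deg0 f0 g0; last by exists f@_n, n.
move=> d d0; rewrite fV -[1]/(lone k) /lone mcoeffU.
by rewrite eq_sym (negPf d0).
Qed.

Lemma laurent_monomial_unit (c : k) (n : int) :
  c != 0 -> c *: lvar k ^ n \is a GRing.unit.
Proof.
by move=> c0; rewrite scaler_unit ?unitfE // unitrXz ?lvar_unit.
Qed.

Lemma laurent_monomial_inj (c d : k) (m n : int) : c != 0 ->
  c *: lvar k ^ m = d *: lvar k ^ n -> m = n /\ c = d.
Proof.
move=> c0 /malgP /(_ m); rewrite !lvarX !mcoeffZ !mcoeffU eqxx mulr1.
have [->|nm] := eqVneq n m; first by rewrite mulr1.
by rewrite mulr0 => /eqP; rewrite (negPf c0).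
Qed.

End LaurentDomain.

(** * Grading, normal form and units of a generalized Weyl algebra *)

Section GwaNormalForm.
Variables (k : fieldType) (R : comAlgType k) (sigma : algaut R) (a : R).
Local Notation A := (gwa sigma a).
Local Notation x := (gwa_x sigma a).
Local Notation y := (gwa_y sigma a).
Local Notation cst := (gwa_cst sigma a).
Local Notation sigV := (aut_inv sigma).

(** Lets [z] act on the delta function at 0, which stands for [v_0 = 1]; the values are the left
    coefficients of [z] in the basis [v_n]. *)
Definition gwa_coef (z : A) (n : int) : R :=
  gwa_act sigma a (gwa_repr z) (fun m => (m == 0)%:R) n.

Definition gwa_v (n : int) : A :=
  match n with Posz m => x ^+ m | Negz m => y ^+ m.+1 end.

Lemma gwa_coef_pi t n :
  gwa_coef (gwa_pi sigma a t) n = gwa_act sigma a t (fun m => (m == 0)%:R) n.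
Proof. by rewrite /gwa_coef (gwa_act_eq (gwa_pi_repr sigma a t)). Qed.

Lemma gwa_coefD z w n : gwa_coef (z + w) n = gwa_coef z n + gwa_coef w n.
Proof. exact: (gwa_coef_pi (GAdd (gwa_repr z) (gwa_repr w))). Qed.

Lemma gwa_coefZ c z n : gwa_coef (c *: z) n = c *: gwa_coef z n.
Proof. exact: (gwa_coef_pi (GScale c (gwa_repr z))). Qed.

Lemma gwa_coefN z n : gwa_coef (- z) n = - gwa_coef z n.
Proof. by rewrite -scaleN1r gwa_coefZ scaleN1r. Qed.

Lemma gwa_coef0 n : gwa_coef 0 n = 0.
Proof. by rewrite -(scale0r 0) gwa_coefZ scale0r. Qed.

Lemma gwa_coef_sum I (r : seq I) (F : I -> A) n :
  gwa_coef (\sum_(i <- r) F i) n = \sum_(i <- r) gwa_coef (F i) n.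
Proof. exact: (big_morph (gwa_coef^~ n) (fun z w => gwa_coefD z w n) (gwa_coef0 n)). Qed.

Lemma gwa_coef_pi_mul t w n :
  gwa_coef (gwa_pi sigma a t * w) n = gwa_act sigma a t (gwa_coef w) n.
Proof.
elim/gwa_ind: w => u; rewrite -[_ * _]gwa_piM gwa_coef_pi /=.
by congr (gwa_act _ _ t _ n); apply/functional_extensionality_dep => m; rewrite gwa_coef_pi.
Qed.

Lemma gwa_coef_cst r w n : gwa_coef (cst r * w) n = r * gwa_coef w n.
Proof. exact: (@gwa_coef_pi_mul (GCst r) w n). Qed.

Lemma gwa_coef_x w n : gwa_coef (x * w) n =
  sigma (gwa_coef w (n - 1)) * (if (0 <= n - 1)%R then 1 else sigma a).
Proof. exact: (@gwa_coef_pi_mul GX w n). Qed.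

Lemma gwa_coef_y w n : gwa_coef (y * w) n =
  sigV (gwa_coef w (n + 1)) * (if (n + 1 <= 0)%R then 1 else a).
Proof. exact: (@gwa_coef_pi_mul GY w n). Qed.

Lemma aut_inv1 : sigV 1 = 1.
Proof. by rewrite -{1}(rmorph1 sigma) autK. Qed.

Lemma aut_inv0 : sigV 0 = 0.
Proof. by rewrite -{1}(rmorph0 sigma) autK. Qed.

(** Each factor moves the delta function one step further from degree 0, so [a] never appears; this
    gives linear independence of the [v_n] over [R]. *)
Lemma gwa_coef_v m n : gwa_coef (gwa_v m) n = (m == n)%:R.
Proof.
have c1 d : gwa_coef 1 d = (d == 0)%:R by rewrite gwa_coef_pi /= mul1r.
case: m => m /=.
  elim: m n => [|m IHm] n; first by rewrite expr0 c1 eq_sym.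
  rewrite exprS gwa_coef_x IHm rmorph_nat.
  have -> : (Posz m.+1 == n) = (Posz m == n - 1) by apply/eqP/eqP; lia.
  by have [<-|_] := eqVneq (Posz m) (n - 1); rewrite ?mul0r // mulr1.
have c2 j d : gwa_coef (y ^+ j) d = (- Posz j == d)%:R.
  elim: j d => [|j IHj] d; first by rewrite expr0 c1 eq_sym oppr0.
  rewrite exprS gwa_coef_y IHj.
  have -> : (- Posz j.+1 == d) = (- Posz j == d + 1) by apply/eqP/eqP; lia.
  have [<-|_] := eqVneq (- Posz j) (d + 1); last by rewrite aut_inv0 mul0r.
  rewrite aut_inv1 ifT ?mulr1 //; lia.
by rewrite c2 NegzE.
Qed.

Lemma gwa_coef_homog r m n : gwa_coef (cst r * gwa_v m) n = r * (m == n)%:R.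
Proof. by rewrite gwa_coef_cst gwa_coef_v. Qed.

Lemma gwa_x_v n : exists e, x * gwa_v n = cst e * gwa_v (n + 1).
Proof.
case: n => n; first by exists 1; rewrite rmorph1 mul1r /= addn1 exprS.
exists (sigma a); rewrite NegzE /= exprS mulrA gwa_xy; congr (_ * _).
case: n => [|n]; first by [].
by have -> : - Posz n.+2 + 1 = Negz n by rewrite NegzE; lia.
Qed.

Lemma gwa_y_v n : exists e, y * gwa_v n = cst e * gwa_v (n - 1).
Proof.
case: n => [[|n]|n].
- by exists 1; rewrite rmorph1 mul1r /= mulr1.
- exists a; have -> : Posz n.+1 - 1 = Posz n by lia.
  by rewrite /= exprS mulrA gwa_yx.
- exists 1; rewrite rmorph1 mul1r.
  by have -> : Negz n - 1 = Negz n.+1 by lia.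
Qed.

(** The sums of terms [r v_n] contain 1 and are stable under left multiplication by any term, so
    they exhaust the algebra. *)
Lemma gwa_normal_form z :
  exists s : seq int, uniq s /\ z = \sum_(n <- s) cst (gwa_coef z n) * gwa_v n.
Proof.
pose nf z := exists s : seq (R * int), z = \sum_(p <- s) cst p.1 * gwa_v p.2.
have nfD u w : nf u -> nf w -> nf (u + w).
  by move=> [s ->] [s' ->]; exists (s ++ s'); rewrite big_cat.
have nf_sum I (r : seq I) (F : I -> A) : (forall i, nf (F i)) -> nf (\sum_(i <- r) F i).
  move=> nfF; elim: r => [|i r IHr]; first by exists [::]; rewrite !big_nil.
  by rewrite big_cons; exact: nfD.
have nf1 r n : nf (cst r * gwa_v n).
  by exists [:: (r, n)]; rewrite big_seq1.
have nf_lmul t : forall w, nf w -> nf (gwa_pi sigma a t * w).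
  elim: t => [r|||t IHt u IHu|t IHt|t IHt u IHu|c t IHt] w nfw.
  - case: nfw => s ->; rewrite mulr_sumr; apply: nf_sum => -[r' n] /=.
    by rewrite -/(cst r) mulrA -rmorphM; exact: nf1.
  - case: nfw => s ->; rewrite mulr_sumr; apply: nf_sum => -[r' n] /=.
    have [e xe] := gwa_x_v n.
    by rewrite -/x mulrA gwa_xr -mulrA xe mulrA -rmorphM; exact: nf1.
  - case: nfw => s ->; rewrite mulr_sumr; apply: nf_sum => -[r' n] /=.
    have [e ye] := gwa_y_v n.
    by rewrite -/y mulrA gwa_yr -mulrA ye mulrA -rmorphM; exact: nf1.
  - by rewrite gwa_piD mulrDl; apply: nfD; [exact: IHt | exact: IHu].
  - rewrite gwa_piN mulNr; have [s ->] := IHt w nfw; rewrite -sumrN.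
    by apply: nf_sum => -[r' n]; rewrite -mulNr -rmorphN; exact: nf1.
  - by rewrite gwa_piM -mulrA; apply/IHt/IHu.
  - rewrite gwa_piZ -scalerAl; have [s ->] := IHt w nfw; rewrite scaler_sumr.
    by apply: nf_sum => -[r' n]; rewrite scalerAl -linearZ; exact: nf1.
have [s zE] : nf z.
  elim/gwa_ind: z => t; rewrite -[gwa_pi _ _ _]mulr1; apply: nf_lmul.
  by have := nf1 1 0; rewrite rmorph1 mul1r.
(* Repeated degrees are merged by expanding each summand over all degrees and exchanging the two
   sums. *)
exists (undup (map snd s)); split; first exact: undup_uniq.
have {1}-> : z = \sum_(p <- s) \sum_(n <- undup (map snd s))
    cst (gwa_coef (cst p.1 * gwa_v p.2) n) * gwa_v n.
  rewrite zE big_seq [RHS]big_seq; apply: eq_bigr => -[r m] ps /=.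
  rewrite (bigD1_seq m) /= ?undup_uniq ?mem_undup //; last first.
    by apply/mapP; exists (r, m).
  rewrite big1 => [|n mn]; last first.
    by rewrite gwa_coef_homog eq_sym (negPf mn) mulr0 rmorph0 mul0r.
  by rewrite addr0 gwa_coef_homog eqxx mulr1.
rewrite exchange_big; apply: eq_bigr => n _.
by rewrite -mulr_suml -rmorph_sum -gwa_coef_sum -zE.
Qed.

Lemma gwa_coef_inj z w : gwa_coef z =1 gwa_coef w -> z = w.
Proof.
move=> zw; apply/eqP; rewrite -subr_eq0; apply/eqP.
have [s [_ ->]] := gwa_normal_form (z - w); apply: big1 => n _.
by rewrite gwa_coefD gwa_coefN zw subrr rmorph0 mul0r.
Qed.

Lemma gwa_homogP z n : (forall m, gwa_coef z m != 0 -> m = n) ->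
  z = cst (gwa_coef z n) * gwa_v n.
Proof.
move=> zn; apply: gwa_coef_inj => m; rewrite gwa_coef_homog.
have [->|nm] := eqVneq n m; first by rewrite mulr1.
rewrite mulr0; apply: contrapT => /eqP /zn mn; by rewrite mn eqxx in nm.
Qed.

Hypothesis R_domain : forall r s : R, (r * s == 0) = (r == 0) || (s == 0).

Lemma aut_inv_eq0 r : (sigV r == 0) = (r == 0).
Proof. by rewrite -{1}aut_inv0 (inj_eq (can_inj (autVK sigma))). Qed.

Lemma aut_eq0 r : (sigma r == 0) = (r == 0).
Proof. by rewrite -{1}(rmorph0 sigma) (inj_eq (can_inj (autK sigma))). Qed.

(* [C n] is the factor in [v_m v_n = C n v_(m + n)]. *)
Lemma gwa_coef_vmul m : exists (t : R -> R) (C : int -> R),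
  [/\ forall r, (t r == 0) = (r == 0), a != 0 -> forall n, C n != 0,
      m != 0 -> (exists s, s * C (- m) = 1) -> exists s, s * a = 1 &
      forall w d, gwa_coef (gwa_v m * w) d = t (gwa_coef w (d - m)) * C (d - m)].
Proof.
have R1 : (1 : R) != 0 by exact: oner_neq0.
have neg j : exists (t : R -> R) (C : int -> R),
  [/\ forall r, (t r == 0) = (r == 0), a != 0 -> forall n, C n != 0,
      j != 0%N -> (exists s, s * C (Posz j) = 1) -> exists s, s * a = 1 &
      forall w d, gwa_coef (y ^+ j * w) d = t (gwa_coef w (d + Posz j)) * C (d + Posz j)].
  elim: j => [|j [t [C [t0 C0 _ tC]]]].
    exists id, (fun=> 1); split=> // w d; by rewrite expr0 mul1r mulr1 addr0.
  exists (sigV \o t).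
  exists (fun n => sigV (C n) * if (n - Posz j <= 0)%R then 1 else a); split.
  - by move=> r; rewrite /= aut_inv_eq0.
  - move=> a0 n; rewrite R_domain negb_or aut_inv_eq0 C0 //=.
    by case: ifP.
  (* At [n = j + 1] the outermost [y] meets degree 1 and contributes a factor [a], which is
     invertible as soon as the product is. *)
  - move=> _ [s]; rewrite ifF; last by lia.
    by rewrite mulrA => <-; eexists.
  - move=> w d; rewrite exprS -mulrA gwa_coef_y tC (aut_invM sigma) /=.
    rewrite -mulrA -!addrA -intS; congr (_ * (_ * _)).
    by have -> : d + (Posz j.+1 - Posz j) = d + 1 by lia.
case: m => m /=.
  elim: m => [|m [t [C [t0 C0 _ tC]]]].
    exists id, (fun=> 1); split=> // w d; by rewrite expr0 mul1r mulr1 subr0.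
  exists (sigma \o t).
  exists (fun n => sigma (C n) * if (0 <= n + Posz m)%R then 1 else sigma a); split.
  - by move=> r; rewrite /= aut_eq0.
  - move=> a0 n; rewrite R_domain negb_or aut_eq0 C0 //=.
    by case: ifP; rewrite ?aut_eq0.
  - move=> _ [s]; rewrite ifF; last by lia.
    (* Here the new factor is [sigma a]; the inverse automorphism carries its invertibility over to
       [a]. *)
    rewrite mulrA => /(congr1 sigV); rewrite aut_invM aut_inv1 autK => <-.
    by eexists.
  - move=> w d; rewrite exprS -mulrA gwa_coef_x tC rmorphM /=.
    rewrite -mulrA; have -> : d - 1 - Posz m = d - Posz m.+1 by lia.
    by have -> : d - Posz m.+1 + Posz m = d - 1 by lia.
have [t [C [t0 C0 Cu tC]]] := neg m.+1.
by exists t, C; split=> // [_|w d]; rewrite NegzE opprK ?tC //; exact: Cu.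
Qed.

(** As [a] is nonzero and [R] a domain, the factors [C] never vanish, so the degree [i] part of [z]
    contributes to degree [d] exactly when both coefficients involved are nonzero. *)
Lemma gwa_prod_deg0 (z w : A) : a != 0 -> z != 0 -> w != 0 ->
  (forall d, d != 0 -> gwa_coef (z * w) d = 0) ->
  exists n r s, [/\ r != 0, s != 0, z = cst r * gwa_v n & w = cst s * gwa_v (- n)].
Proof.
move=> a0 z0 w0 zw0.
have nz (u : A) : u != 0 -> exists n, gwa_coef u n != 0.
  move=> u0; apply: contrapT => no; move/negP: u0; apply; apply/eqP.
  apply: gwa_coef_inj => n; rewrite gwa_coef0; apply: contrapT => /eqP un.
  by apply: no; exists n.
have [m zm] := nz z z0; have [n wn] := nz w w0.
have [sz [usz zE]] := gwa_normal_form z.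
have [sw [usw wE]] := gwa_normal_form w.
have supp u s : u = \sum_(n <- s) cst (gwa_coef u n) * gwa_v n ->
    forall n, gwa_coef u n != 0 -> n \in s.
  move=> uE i; apply: contraNT => is_; rewrite uE gwa_coef_sum big_seq.
  apply/eqP; apply: big1 => j js; rewrite gwa_coef_homog.
  by rewrite (_ : (j == i) = false) ?mulr0 //; apply: contraNF is_ => /eqP <-.
have [||zm' wm zn wn'] := @graded_prod_deg0 R (fun i => gwa_coef z i != 0)
  (fun i => gwa_coef w i != 0) sz sw (gwa_coef (z * w))
  (fun i d => gwa_coef (cst (gwa_coef z i) * gwa_v i * w) d) m n usz
  (supp _ _ zE) (supp _ _ wE) _ _ zm wn zw0.
- by move=> d; rewrite {1}zE mulr_suml gwa_coef_sum.
- move=> i d; have [t [C [t0 C0 _ tC]]] := gwa_coef_vmul i.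
  by rewrite -mulrA gwa_coef_cst tC !R_domain t0 (negPf (C0 a0 _)) orbF negb_or.
by exists m, (gwa_coef z m), (gwa_coef w (- m)); split=> //; exact: gwa_homogP.
Qed.

Lemma gwa_homogX r n j : exists e, (cst r * gwa_v n) ^+ j = cst e * gwa_v (n * Posz j).
Proof.
elim: j => [|j [e IHj]].
  by exists 1; rewrite expr0 rmorph1 mul1r mulr0.
rewrite exprS IHj -mulrA.
have [t [C [t0 _ _ tC]]] := gwa_coef_vmul n; eexists; apply: gwa_homogP => d.
rewrite gwa_coef_cst tC gwa_coef_homog.
have [nd|nd] := eqVneq (n * Posz j) (d - n); first by rewrite intS; lia.
by rewrite mulr0 (_ : t 0 = 0) ?mul0r ?mulr0 ?eqxx //; apply/eqP; rewrite t0.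
Qed.

(** The product rule for opposite degrees; the clause on inverses later excludes units of nonzero
    degree. *)
Lemma gwa_homog_mul r s n :
  exists t C, [/\ (t == 0) = (s == 0), a != 0 -> C != 0,
    n != 0 -> (exists s', s' * C = 1) -> exists s', s' * a = 1 &
    cst r * gwa_v n * (cst s * gwa_v (- n)) = cst (r * (t * C))].
Proof.
have [t [C [t0 C0 Cu tC]]] := gwa_coef_vmul n.
exists (t s), (C (- n)); split=> // [a0|]; first exact: C0.
apply: gwa_coef_inj => d; rewrite -(mulr1 (cst (r * _))) -mulrA !gwa_coef_cst tC.
rewrite gwa_coef_homog (gwa_coef_v 0); have [<-|d0] := eqVneq 0 d.
  by rewrite sub0r eqxx !mulr1.
have -> : (- n == d - n) = false by apply/eqP; move: d0 => /eqP; lia.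
by rewrite !mulr0 (_ : t 0 = 0) ?mul0r ?mulr0 //; apply/eqP; rewrite t0.
Qed.

Lemma gwa_mulf_eq0 (z w : A) : a != 0 -> z * w = 0 -> z = 0 \/ w = 0.
Proof.
move=> a0 zw; have [->|z0] := eqVneq z 0; [by left | right].
apply: contrapT => /eqP w0.
have [|n [r [s [r0 s0 zE wE]]]] := gwa_prod_deg0 a0 z0 w0.
  by move=> d _; rewrite zw gwa_coef0.
have [t [C [t0 C0 _]]] := gwa_homog_mul r s n.
rewrite -zE -wE zw -(rmorph0 (gwa_cst sigma a)) => /gwa_cst_inj/esym/eqP.
by rewrite !R_domain t0 (negPf r0) (negPf s0) (negPf (C0 a0)).
Qed.

(** As 1 has degree 0, both factors are homogeneous of opposite degrees; a nonzero degree would make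
    [a] invertible. *)
Lemma gwa_unit_cst (z w : A) : a != 0 -> ~ (exists s, s * a = 1) -> z * w = 1 ->
  exists r s, [/\ r * s = 1, z = cst r & w = cst s].
Proof.
move=> a0 na zw.
have A1 : (1 : A) != 0 by exact: oner_neq0.
have z0 : z != 0 by apply: contra_neq A1 => z0; rewrite -zw z0 mul0r.
have w0 : w != 0 by apply: contra_neq A1 => w0; rewrite -zw w0 mulr0.
have [|n [r [s [r0 s0 zE wE]]]] := gwa_prod_deg0 a0 z0 w0.
  by move=> d d0; rewrite zw (gwa_coef_v 0) eq_sym (negPf d0).
have [n0|n0] := eqVneq n 0; last first.
  have [t [C [_ _ Cu]]] := gwa_homog_mul r s n.
  rewrite -zE -wE zw -(rmorph1 (gwa_cst sigma a)) => /gwa_cst_inj/esym rtC.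
  by case: na; apply: Cu => //; exists (r * t); rewrite -mulrA.
move: zE wE; rewrite n0 oppr0 !mulr1 => zE wE; exists r, s; split=> //.
by apply: (@gwa_cst_inj _ _ sigma a); rewrite rmorphM rmorph1 /= -zE -wE.
Qed.

Lemma gwa_x_neq0 : x != 0.
Proof.
apply/eqP => /(congr1 (gwa_coef^~ 1)) /eqP.
by rewrite gwa_coef0 -(expr1 x) (gwa_coef_v 1) oner_eq0.
Qed.

Lemma gwa_y_neq0 : y != 0.
Proof.
apply/eqP => /(congr1 (gwa_coef^~ (-1))) /eqP.
by rewrite gwa_coef0 -(expr1 y) (gwa_coef_v (-1)) oner_eq0.
Qed.

End GwaNormalForm.

(** * Morphisms out of a generalized Weyl algebra, from its universal property *)

Section GwaMorphisms.
Variable k : fieldType.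

(** Uniqueness in the universal property, used to check that two morphisms are mutually inverse. *)
Lemma gwa_endo_id (R : comAlgType k) (s : algaut R) (a : R)
    (phi : {lrmorphism gwa s a -> gwa s a}) :
  (forall r, phi (gwa_cst s a r) = gwa_cst s a r) ->
  phi (gwa_x s a) = gwa_x s a -> phi (gwa_y s a) = gwa_y s a -> phi =1 id.
Proof.
move=> phir phix phiy.
have [e [_ _ _ eU]] := gwa_universal (j := gwa_cst s a)
  (gwa_yx s a) (gwa_xy s a) (gwa_xr s a) (gwa_yr s a).
by move=> z; rewrite (eU phi) // -(eU idfun).
Qed.

Lemma alg_iso_inv (A B : algType k) (phi : {lrmorphism A -> B}) (g : B -> A) :
  cancel phi g -> cancel g phi -> exists psi : {lrmorphism B -> A}, psi =1 g.
Proof.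
move=> phiK gK.
have g_lin : linear g.
  by move=> c z w; apply: (can_inj phiK); rewrite linearP /= !gK.
have g_mon : monoid_morphism g.
  split; first by rewrite -(rmorph1 phi) phiK.
  by move=> z w; apply: (can_inj phiK); rewrite rmorphM /= !gK.
by exists (HB.pack g (GRing.isLinear.Build _ _ _ _ _ g_lin)
   (GRing.isMonoidMorphism.Build _ _ _ g_mon) : {lrmorphism B -> A}).
Qed.

Lemma alg_iso_sym (A B : algType k) : alg_iso A B -> alg_iso B A.
Proof.
move=> [phi [g phiK gK]]; have [psi psiE] := alg_iso_inv phiK gK.
by exists psi, phi => z; rewrite psiE.
Qed.

Lemma alg_iso_trans (A B C : algType k) : alg_iso A B -> alg_iso B C -> alg_iso A C.
Proof.
by move=> [f bf] [g bg]; exists (g \o f : {lrmorphism A -> C}); exact: bij_comp.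
Qed.

(** Scaling only [y] by [u] sends [y x] to [u b = theta a] and keeps the commutation rules, as [S]
    is commutative. *)
Lemma gwa_hom (R S : comAlgType k) (s1 : algaut R) (s2 : algaut S)
    (a : R) (b u : S) (theta : {lrmorphism R -> S}) :
  (forall r, theta (s1 r) = s2 (theta r)) -> theta a = u * b ->
  exists phi : {lrmorphism gwa s1 a -> gwa s2 b},
    [/\ forall r, phi (gwa_cst s1 a r) = gwa_cst s2 b (theta r),
        phi (gwa_x s1 a) = gwa_x s2 b &
        phi (gwa_y s1 a) = gwa_cst s2 b u * gwa_y s2 b].
Proof.
move=> theta_s theta_a.
have theta_sV r : theta (aut_inv s1 r) = aut_inv s2 (theta r).
  by apply: (can_inj (autK s2)); rewrite -theta_s !autVK.
have [||||phi [phir phix phiy _]] := @gwa_universal k R s1 a (gwa s2 b)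
  (gwa_cst s2 b \o theta) (gwa_x s2 b) (gwa_cst s2 b u * gwa_y s2 b).
- by rewrite -mulrA gwa_yx -rmorphM -theta_a.
- by rewrite mulrA gwa_xr -mulrA gwa_xy /= theta_s theta_a !rmorphM.
- by move=> r; rewrite /= gwa_xr theta_s.
- move=> r; rewrite /= -mulrA gwa_yr theta_sV !mulrA -!rmorphM.
  by rewrite mulrC.
by exists phi.
Qed.

(** The inverse comes from the same construction, since [theta' b = theta' v * a]. *)
Lemma gwa_iso (R S : comAlgType k) (s1 : algaut R) (s2 : algaut S)
    (a : R) (b u v : S) (theta : {lrmorphism R -> S}) (theta' : {lrmorphism S -> R}) :
  cancel theta theta' -> cancel theta' theta ->
  (forall r, theta (s1 r) = s2 (theta r)) -> v * u = 1 -> theta a = u * b ->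
  alg_iso (gwa s1 a) (gwa s2 b).
Proof.
move=> tK t'K ts vu ta.
have t's r : theta' (s2 r) = s1 (theta' r).
  by apply: (can_inj tK); rewrite ts !t'K.
have t'b : theta' b = theta' v * a.
  by apply: (can_inj tK); rewrite rmorphM /= !t'K ta mulrA vu mul1r.
have [phi [phir phix phiy]] := gwa_hom ts ta.
have [psi [psir psix psiy]] := gwa_hom t's t'b.
exists phi, psi => z.
  apply: (gwa_endo_id (phi := psi \o phi)) => [r||] /=.
  - by rewrite phir psir tK.
  - by rewrite phix psix.
  - by rewrite phiy rmorphM /= psir psiy mulrA -!rmorphM mulrC vu !rmorph1 mul1r.
apply: (gwa_endo_id (phi := phi \o psi)) => [r||] /=.
- by rewrite psir phir t'K.
- by rewrite psix phix.
- by rewrite psiy rmorphM /= phir phiy mulrA -!rmorphM t'K vu !rmorph1 mul1r.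
Qed.

(** For an involution [x] and [y] obey the same commutation rule, so they may be exchanged once [a]
    is replaced by its image. *)
Lemma gwa_swap_hom (R : comAlgType k) (s : algaut R) (a b : R) :
  (forall r, s (s r) = r) -> b = s a ->
  exists phi : {lrmorphism gwa s a -> gwa s b},
    [/\ forall r, phi (gwa_cst s a r) = gwa_cst s b r,
        phi (gwa_x s a) = gwa_y s b & phi (gwa_y s a) = gwa_x s b].
Proof.
move=> ss bE.
have sV r : aut_inv s r = s r by apply: (can_inj (autK s)); rewrite autVK ss.
have [||||phi [phir phix phiy _]] := @gwa_universal k R s a (gwa s b)
  (gwa_cst s b) (gwa_y s b) (gwa_x s b).
- by rewrite gwa_xy bE ss.
- by rewrite gwa_yx bE.
- by move=> r; rewrite gwa_yr sV.
- by move=> r; rewrite gwa_xr sV.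
by exists phi.
Qed.

Lemma gwa_swap_iso (R : comAlgType k) (s : algaut R) (a : R) :
  (forall r, s (s r) = r) -> alg_iso (gwa s a) (gwa s (s a)).
Proof.
move=> ss.
have [phi [phir phix phiy]] := gwa_swap_hom ss (erefl (s a)).
have [psi [psir psix psiy]] := gwa_swap_hom ss (esym (ss a)).
exists phi, psi => z.
  by apply: (gwa_endo_id (phi := psi \o phi)) => [r||] /=;
    rewrite ?phir ?psir ?phix ?psiy ?phiy ?psix.
by apply: (gwa_endo_id (phi := phi \o psi)) => [r||] /=;
  rewrite ?psir ?phir ?psix ?phiy ?psiy ?phix.
Qed.

End GwaMorphisms.

(** * Monomial substitutions and the inversion automorphism *)

Lemma int_mul_eq1 (m n : int) : m * n = 1 -> m = n /\ (n = 1 \/ n = -1).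
Proof.
move=> mn; have /eqP := congr1 absz mn; rewrite abszM muln_eq1 => /andP[/eqP ? /eqP ?].
nia.
Qed.

Section LaurentMonomials.
Variable k : fieldType.
Local Notation L := (laurent k).
Local Notation h := (lvar k).

Lemma lvarXz_mul (m n : int) : h ^ m * h ^ n = h ^ (m + n).
Proof. by rewrite exprzDr ?lvar_unit. Qed.

Lemma laurent_monomialXz (c : k) (m i : int) :
  c != 0 -> (c *: h ^ m) ^ i = c ^ i *: h ^ (m * i).
Proof.
move=> c0; have pos (j : nat) : (c *: h ^ m) ^+ j = c ^+ j *: h ^ (m * Posz j).
  elim: j => [|j IHj]; first by rewrite !expr0 mulr0 expr0z scale1r.
  rewrite !exprS IHj -scalerAl -scalerAr scalerA lvarXz_mul.
  by congr (_ *: h ^ _); rewrite intS; lia.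
case: i => j; first exact: pos.
rewrite NegzE -!exprnN pos invrZ ?unitfE ?expf_neq0 ?unitrXz ?lvar_unit //.
by rewrite invr_expz mulrN.
Qed.

Lemma leval_monomial (u : L) (c : k) (i : int) : leval u (c *: h ^ i) = c *: u ^ i.
Proof.
rewrite (_ : c *: h ^ i = << c *g i >>) ?levalU // lvarX.
by apply/malgP => j; rewrite mcoeffZ !mcoeffU mulr_natr.
Qed.

Lemma leval0 (u : L) : leval u 0 = 0.
Proof. by rewrite /leval msupp0 big_seq_fset0. Qed.

Lemma lvar_monomial : h = 1 *: h ^ 1.
Proof. by rewrite expr1z scale1r. Qed.

(** The target may be a generalized Weyl algebra, with no inverse operation at hand, so negative
    powers are compared by uniqueness of two-sided inverses. *)
Lemma lrmorph_laurent_ext (B : algType k) (f g : {lrmorphism L -> B}) :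
  f h = g h -> f =1 g.
Proof.
move=> fg; have nat_fg n : f (h ^+ n) = g (h ^+ n) by rewrite !rmorphXn /= fg.
have fgX i : f (h ^ i) = g (h ^ i).
  case: i => n; first exact: nat_fg.
  have hV : h ^ (Negz n) * h ^+ n.+1 = 1 by rewrite NegzE -exprnN mulVr ?unitrX ?lvar_unit.
  have fV := rmorph1 f; rewrite -{1}hV rmorphM /= in fV.
  have gV := rmorph1 g; rewrite -{1}hV mulrC rmorphM /= in gV.
  by rewrite -[LHS]mulr1 -gV mulrA -nat_fg fV mul1r.
move=> z; rewrite (laurentE z) !linear_sum; apply: eq_bigr => i _.
by rewrite !linearZ /= fgX.
Qed.

(** As [eps] squares to 1, the composite sends [h] to [c * c^-1 ^ (eps * eps)] times [h], which is
    [h]. *)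
Lemma laurent_dilationK (c : k) (eps : int) (f : L) : c != 0 -> eps * eps = 1 ->
  leval (c^-1 ^ eps *: h ^ eps) (leval (c *: h ^ eps) f) = f.
Proof.
move=> c0 e1; have d0 : c^-1 ^ eps != 0 by rewrite expfz_neq0 ?invr_eq0.
pose F : {lrmorphism L -> L} :=
  leval_lrmorphism (laurent_monomial_unit eps d0) \o
  leval_lrmorphism (laurent_monomial_unit eps c0).
rewrite -[LHS]/(F f) -[RHS]/(idfun f); apply: lrmorph_laurent_ext => /=.
rewrite leval_lvar leval_monomial laurent_monomialXz // scalerA e1.
by rewrite exprz_exp e1 !expr1z mulfV ?scale1r.
Qed.

Section Inversion.
Variables (q : k) (s : algaut L).
Hypotheses (q0 : q != 0) (sh : s h = q *: h^-1).

Lemma inversionK f : s (s f) = f.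
Proof.
rewrite -[LHS]/((s \o s : {lrmorphism L -> L}) f) -[RHS]/(idfun f).
apply: lrmorph_laurent_ext => /=.
rewrite sh linearZ /= rmorphV ?lvar_unit //= sh invrZ ?unitfE ?unitrV ?lvar_unit //.
by rewrite invrK scalerA mulfV ?scale1r.
Qed.

Lemma inversion_aut_inv f : aut_inv s f = s f.
Proof. by apply: (can_inj (autK s)); rewrite autVK inversionK. Qed.

Lemma inversion_leval f : s f = leval (q *: h ^ (-1)) f.
Proof. by rewrite (lrmorph_leval s) /= sh exprN1. Qed.

Lemma inversion_monomial c i : s (c *: h ^ i) = (c * q ^ i) *: h ^ (- i).
Proof.
by rewrite inversion_leval leval_monomial laurent_monomialXz // scalerA mulN1r.
Qed.

Lemma inversion_nontrivial : s h != h.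
Proof.
apply/eqP; rewrite sh {2}lvar_monomial -exprN1 => /laurent_monomial_inj [] //.
Qed.

End Inversion.
End LaurentMonomials.

(** * Constraints that a morphism puts on the parameters *)

Section IsoAnalysis.
Variable k : fieldType.
Local Notation L := (laurent k).
Local Notation h := (lvar k).

Lemma laurent_nonunitP (a : L) : a \isn't a GRing.unit -> ~ (exists s, s * a = 1).
Proof. by move=> na [s sa]; case/negP: na; apply/unitrPr; exists s; rewrite mulrC. Qed.

Section Morphism.
Variables (s1 s2 : algaut L) (a1 a2 : L).
Variable phi : {lrmorphism gwa s1 a1 -> gwa s2 a2}.
Hypothesis phi_inj : injective phi.
Local Notation cst1 := (gwa_cst s1 a1).
Local Notation cst2 := (gwa_cst s2 a2).
Local Notation x1 := (gwa_x s1 a1).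
Local Notation y1 := (gwa_y s1 a1).

Lemma inj_neq0 z : z != 0 -> phi z != 0.
Proof. by apply: contra_neq => z0; apply: phi_inj; rewrite z0 rmorph0. Qed.

(** If [a1 = 0], the images of [y] and [x] are nonzero with product 0, impossible when [a2] is
    nonzero. *)
Lemma gwa_iso_zero : a1 = 0 -> a2 = 0.
Proof.
move=> a10; apply: contrapT => /eqP a20.
have yx0 : phi y1 * phi x1 = 0 by rewrite -rmorphM gwa_yx [X in gwa_cst _ _ X]a10 !rmorph0.
have [/eqP|/eqP] := gwa_mulf_eq0 (@laurent_mulf_eq0 k) a20 yx0; apply/negP/inj_neq0.
  exact: gwa_y_neq0.
exact: gwa_x_neq0.
Qed.

Lemma gwa_hom_cst_unit (u v : L) : a2 != 0 -> a2 \isn't a GRing.unit -> u * v = 1 ->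
  exists2 w, phi (cst1 u) = cst2 w & w \is a GRing.unit.
Proof.
move=> a20 /laurent_nonunitP na2 uv.
have pp : phi (cst1 u) * phi (cst1 v) = 1 by rewrite -!rmorphM uv !rmorph1.
have [r [s [rs -> _]]] := gwa_unit_cst (@laurent_mulf_eq0 k) a20 na2 pp.
by exists r => //; apply/unitrPr; exists s.
Qed.

(** If [a1] is a unit, so is [x]. Were [a2] not a unit, the images of [x] and [h] would be constants
    and commute, though [x] and [h] do not. *)
Lemma gwa_iso_unit (q : k) : q != 0 -> s1 h = q *: h^-1 ->
  a1 \is a GRing.unit -> a2 != 0 -> a2 \is a GRing.unit.
Proof.
move=> q0 s1h ua1 a20; apply: contrapT => /negP na2.
have xi : phi x1 * phi (y1 * cst1 (s1 a1)^-1) = 1.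
  by rewrite -rmorphM mulrA gwa_xy -rmorphM divrr ?rmorph1 // rmorph_unit.
have [r [r' [rr' xE _]]] := gwa_unit_cst (@laurent_mulf_eq0 k) a20 (laurent_nonunitP na2) xi.
have [w wE _] := gwa_hom_cst_unit a20 na2 (mulrV (lvar_unit k)).
have /negP := inversion_nontrivial q0 s1h; apply; apply/eqP.
apply: (@gwa_cst_inj _ _ s1 a1); apply: phi_inj; rewrite wE.
have : phi x1 * phi (cst1 h) = phi (cst1 (s1 h)) * phi x1 by rewrite -!rmorphM gwa_xr.
rewrite xE wE -rmorphM mulrC rmorphM /= => /(congr1 ( *%R^~ (cst2 r'))).
by rewrite -!mulrA -rmorphM rr' rmorph1 !mulr1.
Qed.

Hypotheses (a2_neq0 : a2 != 0) (a2_nunit : a2 \isn't a GRing.unit).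

(** The image of [h] is a unit, hence a monomial constant, and it determines the images of all
    constants. *)
Lemma gwa_hom_laurent : exists (alpha : k) (i : int) (theta : {lrmorphism L -> L}),
  [/\ alpha != 0, theta h = alpha *: h ^ i & forall f, phi (cst1 f) = cst2 (theta f)].
Proof.
have [w wE /laurent_unit_monomial[c [i [c0 wE']]]] :=
  gwa_hom_cst_unit a2_neq0 a2_nunit (mulrV (lvar_unit k)).
exists c, i, (leval_lrmorphism (laurent_monomial_unit i c0)); split=> //.
  exact: leval_lvar.
move=> f; rewrite -[LHS]/((phi \o cst1 : {lrmorphism L -> _}) f).
rewrite -[RHS]/((cst2 \o leval_lrmorphism (laurent_monomial_unit i c0) : {lrmorphism L -> _}) f).
by apply: lrmorph_laurent_ext; rewrite /= wE wE' leval_lvar.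
Qed.

Variable theta : {lrmorphism L -> L}.
Hypothesis phi_cst : forall f, phi (cst1 f) = cst2 (theta f).

(** The product [y * x] is a constant, so its image has degree 0 and both factors are homogeneous of
    opposite degrees. *)
Lemma gwa_hom_xy_homog : exists n r s, [/\ r != 0, s != 0,
  phi x1 = cst2 r * gwa_v s2 a2 n & phi y1 = cst2 s * gwa_v s2 a2 (- n)].
Proof.
have yx : phi y1 * phi x1 = cst2 (theta a1) by rewrite -rmorphM /= gwa_yx phi_cst.
have [||d d0|n [s [r [s0 r0 yE xE]]]] :=
  gwa_prod_deg0 (@laurent_mulf_eq0 k) a2_neq0 (z := phi y1) (w := phi x1).
- exact/inj_neq0/gwa_y_neq0.
- exact/inj_neq0/gwa_x_neq0.
- by rewrite yx -(mulr1 (cst2 _)) gwa_coef_cst (gwa_coef_v _ _ 0) eq_sym (negPf d0) mulr0.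
by exists (- n), r, s; rewrite opprK.
Qed.

(** Degrees get multiplied by [n], which allows counting degrees in the composite with the
    inverse. *)
Lemma gwa_hom_v_homog (n : int) (r s : L) :
  phi x1 = cst2 r * gwa_v s2 a2 n -> phi y1 = cst2 s * gwa_v s2 a2 (- n) ->
  forall m, exists e, phi (gwa_v s1 a1 m) = cst2 e * gwa_v s2 a2 (n * m).
Proof.
move=> xE yE [m|m] /=; rewrite rmorphXn /=.
  by rewrite xE; exact: (gwa_homogX s2 a2 (@laurent_mulf_eq0 k) r n m).
rewrite yE; have [e ->] := gwa_homogX s2 a2 (@laurent_mulf_eq0 k) s (- n) m.+1.
by exists e; rewrite NegzE mulNr mulrN.
Qed.

(** Both conclusions are images of relations: [x f = s1(f) x], after cancelling [r], and
    [y x = a1]. *)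
Lemma gwa_hom_deg1 (q : k) (n : int) (r s : L) : q != 0 -> s2 h = q *: h^-1 ->
  n = 1 \/ n = -1 -> r != 0 ->
  phi x1 = cst2 r * gwa_v s2 a2 n -> phi y1 = cst2 s * gwa_v s2 a2 (- n) ->
  (forall f, s2 (theta f) = theta (s1 f)) /\
  exists t, theta a1 = t * (if n == 1 then a2 else s2 a2).
Proof.
move=> q0 s2h n1 r0 xE yE.
(* Both [v_1 = x] and [v_(-1) = y] twist constants by [s2], which is its own inverse. *)
have vf f : gwa_v s2 a2 n * cst2 f = cst2 (s2 f) * gwa_v s2 a2 n.
  case: n1 => ->; rewrite /= expr1 ?gwa_xr // gwa_yr.
  by rewrite (inversion_aut_inv q0 s2h).
split=> [f|].
  have : phi x1 * cst2 (theta f) = cst2 (theta (s1 f)) * phi x1.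
    by rewrite -!phi_cst -!rmorphM gwa_xr.
  rewrite xE -mulrA vf !mulrA -!rmorphM /= => /(congr1 (fun z => gwa_coef z n)).
  rewrite !gwa_coef_homog eqxx !mulr1 => /eqP.
  rewrite (mulrC (theta _)) -subr_eq0 -mulrBr laurent_mulf_eq0 (negPf r0) /= subr_eq0.
  by move=> /eqP.
have : cst2 (theta a1) = phi y1 * phi x1 by rewrite -phi_cst -rmorphM gwa_yx.
rewrite yE xE; case: n1 => ->; rewrite /= !expr1.
  rewrite mulrA -(mulrA (cst2 s)) gwa_yr -mulrA -mulrA gwa_yx -!rmorphM => /gwa_cst_inj ->.
  by rewrite mulrA; eexists.
rewrite mulrA -(mulrA (cst2 s)) gwa_xr -mulrA -mulrA gwa_xy -!rmorphM => /gwa_cst_inj ->.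
by rewrite rmorphM /= mulrA; eexists.
Qed.

End Morphism.

Lemma gwa_iso_normal_form (q1 q2 : k) (s1 s2 : algaut L) (a1 a2 : L) :
  q1 != 0 -> q2 != 0 -> s1 h = q1 *: h^-1 -> s2 h = q2 *: h^-1 ->
  a1 != 0 -> a2 != 0 -> a1 \isn't a GRing.unit -> a2 \isn't a GRing.unit ->
  alg_iso (gwa s1 a1) (gwa s2 a2) ->
  exists (alpha : k) (i : int) (t : L),
    [/\ alpha != 0, (i = 1 \/ i = -1), t \is a GRing.unit,
        alpha ^+ 2 = q1 * q2 ^ (- i) &
        leval (alpha *: h ^ i) a1 = t * a2 \/ leval (alpha *: h ^ i) a1 = t * s2 a2].
Proof.
move=> q10 q20 s1h s2h a10 a20 na1 na2 iso12.
have [phi [g phiK gK]] := iso12.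
have [psi psiE] : exists psi : {lrmorphism gwa s2 a2 -> gwa s1 a1}, psi =1 g.
  exact: (alg_iso_inv phiK gK).
have psiK : cancel psi phi by move=> z; rewrite psiE gK.
have {}phiK : cancel phi psi by move=> z; rewrite psiE phiK.
have phiI := can_inj phiK; have psiI := can_inj psiK.
have [alpha [i [theta [alpha0 thetah phic]]]] := gwa_hom_laurent phi a20 na2.
have [alpha' [i' [theta' [alpha'0 theta'h psic]]]] := gwa_hom_laurent psi a10 na1.
have tK : cancel theta theta'.
  by move=> f; apply: (@gwa_cst_inj _ _ s1 a1); rewrite -psic -phic phiK.
have t'K : cancel theta' theta.
  by move=> f; apply: (@gwa_cst_inj _ _ s2 a2); rewrite -phic -psic psiK.
(* Exponents of [h] are compared in [theta' (theta h) = h]. *)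
have ii : i' * i = 1.
  have := tK h; rewrite thetah (lrmorph_leval theta') theta'h leval_monomial.
  rewrite laurent_monomialXz // scalerA {2}(lvar_monomial k) => /laurent_monomial_inj[] //.
  by rewrite mulf_neq0 ?expfz_neq0.
have [n [r [s [r0 s0 xE yE]]]] := gwa_hom_xy_homog phiI a20 phic.
have [n' [r' [s' [r'0 s'0 x'E y'E]]]] := gwa_hom_xy_homog psiI a10 psic.
(* Degrees are compared in [psi (phi x) = x]. *)
have nn : n' * n = 1.
  have [e vE] := gwa_hom_v_homog x'E y'E n.
  have /(congr1 (fun z => gwa_coef z 1)) /eqP := phiK (gwa_x s1 a1).
  rewrite xE rmorphM /= psic vE mulrA -rmorphM gwa_coef_homog.
  rewrite -(expr1 (gwa_x s1 a1)) (gwa_coef_v s1 a1 1) eqxx.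
  by have [//|_] := eqVneq (n' * n) 1; rewrite mulr0 eq_sym oner_eq0.
have [n'E n1] := int_mul_eq1 nn; rewrite {}n'E in x'E y'E.
have [ts [t tE]] := gwa_hom_deg1 phic q20 s2h n1 r0 xE yE.
have [t's [t' t'E]] := gwa_hom_deg1 psic q10 s1h n1 r'0 x'E y'E.
have [_ i1] := int_mul_eq1 ii.
exists alpha, i, t; split=> //.
(* Going back and forth multiplies [a1] by [theta' t * v], so this is 1. For [n = -1] the two
   inversions cancel and [v] is [s1 t']. *)
- have a1E : exists v, (theta' t * v - 1) * a1 = 0.
    move: tE t'E; case: ifP => _ tE t'E.
      by exists t'; rewrite mulrBl mul1r -mulrA -t'E -rmorphM /= -tE tK subrr.
    exists (s1 t'); rewrite mulrBl mul1r -mulrA -{1}(inversionK q10 s1h a1).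
    by rewrite -rmorphM /= -t'E t's -rmorphM /= -tE tK subrr.
  have [v /eqP] := a1E; rewrite laurent_mulf_eq0 (negPf a10) orbF subr_eq0 => /eqP tv.
  by apply/unitrPr; exists (theta v); rewrite -(t'K t) -rmorphM /= tv rmorph1.
(* Comparing coefficients in [s2 (theta h) = theta (s1 h)] gives
   [alpha * q2 ^ i = q1 * alpha^-1]. *)
- have := ts h; rewrite thetah (inversion_monomial q20 s2h) s1h linearZ /=.
  rewrite rmorphV ?lvar_unit //= thetah -exprN1 laurent_monomialXz // scalerA.
  move=> /laurent_monomial_inj [|_]; first by rewrite mulf_neq0 ?expfz_neq0.
  rewrite exprN1 => e; rewrite -invr_expz expr2.
  apply: (mulIf (expfz_neq0 i q20)); rewrite -mulrA e mulrCA mulfV // mulr1.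
  by rewrite mulfVK ?expfz_neq0.
rewrite -thetah -(lrmorph_leval theta) tE; case: ifP; by [left | right].
Qed.

End IsoAnalysis.

(** * Isomorphisms induced by monomial substitutions *)

Section DilationIso.
Variable k : fieldType.
Local Notation h := (lvar k).

(** The relation on [alpha] says exactly that the substitution of [alpha h^eps] for [h] intertwines
    [s1] and [s2]. *)
Lemma gwa_dilation_iso (q1 q2 alpha : k) (eps : int) (s1 s2 : algaut (laurent k))
    (a1 b u : laurent k) :
  q1 != 0 -> q2 != 0 -> s1 h = q1 *: h^-1 -> s2 h = q2 *: h^-1 ->
  alpha != 0 -> eps * eps = 1 -> alpha ^+ 2 = q1 * q2 ^ (- eps) ->
  u \is a GRing.unit -> leval (alpha *: h ^ eps) a1 = u * b ->
  alg_iso (gwa s1 a1) (gwa s2 b).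
Proof.
move=> q10 q20 s1h s2h alpha0 e1 alphaE uu ab.
have beta0 : alpha^-1 ^ eps != 0 by rewrite expfz_neq0 ?invr_eq0.
pose theta := leval_lrmorphism (laurent_monomial_unit eps alpha0).
pose theta' := leval_lrmorphism (laurent_monomial_unit eps beta0).
(* Inverting the substitution twice restores [alpha], so one cancellation lemma serves both
   directions. *)
have alphaV : (alpha^-1 ^ eps)^-1 ^ eps = alpha.
  by rewrite invr_expz exprz_exp mulNr e1 exprN1 invrK.
apply: (@gwa_iso _ _ _ s1 s2 a1 b u u^-1 theta theta').
- by move=> f; exact: laurent_dilationK.
- by move=> f; have := laurent_dilationK f beta0 e1; rewrite alphaV.
- move=> f; rewrite -[LHS]/((theta \o s1 : {lrmorphism _ -> _}) f).
  rewrite -[RHS]/((s2 \o theta : {lrmorphism _ -> _}) f).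
  apply: lrmorph_laurent_ext => /=.
  rewrite s1h leval_lvar -exprN1 leval_monomial laurent_monomialXz //.
  rewrite (inversion_monomial q20 s2h) scalerA mulrN1; congr (_ *: _).
  apply: (mulfI alpha0); rewrite exprN1 mulrCA mulfV // mulr1 mulrA -expr2 alphaE.
  by rewrite -mulrA -expfzDr // addNr expr0z mulr1.
- exact: mulVr.
- exact: ab.
Qed.

End DilationIso.

Theorem proposition3p8 (k : fieldType) (q1 q2 : k)
    (q1_neq0 : q1 != 0) (q2_neq0 : q2 != 0)
    (q1_sqrt : exists s : k, s ^+ 2 = q1) (q2_sqrt : exists s : k, s ^+ 2 = q2)
    (a1 a2 : laurent k) (sigma1 sigma2 : algaut (laurent k))
    (sigma1_inv : sigma1 (lvar k) = q1 *: (lvar k)^-1)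
    (sigma2_inv : sigma2 (lvar k) = q2 *: (lvar k)^-1) :
  alg_iso (gwa sigma1 a1) (gwa sigma2 a2) <->
  exists (p : k) (l : int) (tau : nat) (eps : int) (alpha : k),
    [/\ p != 0, (tau = 0%N \/ tau = 1%N) & (eps = 1 \/ eps = -1)] /\
    [/\ alpha != 0, alpha ^+ 2 = q1 * q2 ^ (- eps) &
        leval (q2 ^+ tau *: lvar k ^ ((-1) ^+ tau)) a2
        = p *: (lvar k ^ l * leval (alpha *: lvar k ^ eps) a1)].
Proof.
have tau0 f : leval (q2 ^+ 0 *: lvar k ^ ((-1) ^+ 0)) f = f.
  by rewrite !expr0 scale1r expr1z leval_id.
have tau1 f : leval (q2 ^+ 1 *: lvar k ^ ((-1) ^+ 1)) f = sigma2 f.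
  by rewrite !expr1 (inversion_leval sigma2_inv).
split=> [iso12|[p [l [tau [eps [alpha [[p0 tau01 eps1] [alpha0 alphaE a2E]]]]]]]]; last first.
  have pu := laurent_monomial_unit l p0.
  have iso_b b : b = p *: (lvar k ^ l * leval (alpha *: lvar k ^ eps) a1) ->
      alg_iso (gwa sigma1 a1) (gwa sigma2 b).
    move=> bE; apply: (gwa_dilation_iso (alpha := alpha) (eps := eps)
      (u := (p *: lvar k ^ l)^-1)) sigma1_inv sigma2_inv _ _ _ _ _ => //.
    - by case: eps1 => ->.
    - by rewrite unitrV.
    - by rewrite bE scalerAl mulKr.
  case: tau01 a2E => ->; first by rewrite tau0 => /iso_b.
  (* For [tau = 1] the formula describes [sigma2 a2]; exchanging [x] and [y] returns to [a2]. *)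
  rewrite tau1 => /iso_b iso12; apply: alg_iso_trans iso12 (alg_iso_sym _).
  exact/gwa_swap_iso/inversionK/sigma2_inv.
have iso21 := alg_iso_sym iso12.
have zero12 : a1 = 0 -> a2 = 0.
  by have [phi [g phiK _]] := iso12; exact: (gwa_iso_zero (can_inj phiK)).
have zero21 : a2 = 0 -> a1 = 0.
  by have [phi [g phiK _]] := iso21; exact: (gwa_iso_zero (can_inj phiK)).
(* The square roots give an admissible [alpha] for [eps = 1], used when [a1] is zero or a unit and
   no [alpha] is read off from the isomorphism. *)
have [r1 r1E] := q1_sqrt; have [r2 r2E] := q2_sqrt.
have r10 : r1 != 0 by apply: contra_neq q1_neq0 => z; rewrite -r1E z expr0n.
have r20 : r2 != 0 by apply: contra_neq q2_neq0 => z; rewrite -r2E z expr0n.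
have alpha0 : r1 / r2 != 0 by rewrite mulf_neq0 ?invr_eq0.
have alphaE : (r1 / r2) ^+ 2 = q1 * q2 ^ (- 1) by rewrite exprMn exprVn r1E r2E.
have [a10|a10] := eqVneq a1 0.
  exists 1, 0, 0%N, 1, (r1 / r2); split; split=> //; [exact: oner_neq0|by left|by left|].
  by rewrite tau0 zero12 // a10 leval0 mulr0 scaler0.
have a20 : a2 != 0 by apply: contra_neq a10.
have unit12 : a1 \is a GRing.unit -> a2 \is a GRing.unit.
  move=> ua1; have [phi [g phiK _]] := iso12.
  exact: (gwa_iso_unit (can_inj phiK) q1_neq0 sigma1_inv).
have unit21 : a2 \is a GRing.unit -> a1 \is a GRing.unit.
  move=> ua2; have [phi [g phiK _]] := iso21.
  exact: (gwa_iso_unit (can_inj phiK) q2_neq0 sigma2_inv).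
have [ua1|na1] := boolP (a1 \is a GRing.unit).
  have [p1 [l1 [p10 ->]]] := laurent_unit_monomial ua1.
  have [p2 [l2 [p20 ->]]] := laurent_unit_monomial (unit12 ua1).
  have c0 : p1 * (r1 / r2) ^ l1 != 0 by rewrite mulf_neq0 ?expfz_neq0.
  (* Both parameters are monomials; [p] and [l] come from dividing [a2] by the substituted [a1]. *)
  exists (p2 / (p1 * (r1 / r2) ^ l1)), (l2 - l1), 0%N, 1, (r1 / r2).
  split; split=> //; [by rewrite mulf_neq0 ?invr_eq0|by left|by left|].
  rewrite tau0 leval_monomial laurent_monomialXz // scalerA mul1r.
  by rewrite -scalerAr scalerA divfK // lvarXz_mul subrK.
have na2 : a2 \isn't a GRing.unit by apply: contra na1.
have [alpha [i [t [al0 i1 ut alE tE]]]] :=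
  gwa_iso_normal_form q1_neq0 q2_neq0 sigma1_inv sigma2_inv a10 a20 na1 na2 iso12.
(* The factor [p h^l] is the inverse of the unit [t]. *)
have [p [l [p0 tVE]]] := laurent_unit_monomial (etrans (unitrV t) ut).
have solve b : leval (alpha *: lvar k ^ i) a1 = t * b ->
    b = p *: (lvar k ^ l * leval (alpha *: lvar k ^ i) a1).
  by move=> ->; rewrite scalerAl -tVE mulKr.
case: tE => /solve bE; [exists p, l, 0%N, i, alpha | exists p, l, 1%N, i, alpha].
  by split; split=> //; [left | rewrite tau0].
by split; split=> //; [right | rewrite tau1].
Qed.
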